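(* Assume that $\mathbf f(0,0)=\mathbf f(\mathbf K,\mathbf K)=0$, and that $\mathbf f$ is a $C^1$ function possessing the mixed quasimonotone property in $[0,\mathbf K]$. Suppose that $\tilde\varphi,\hat\varphi\in\mathcal C_{[0,\mathbf K]}(\mathbb R,\mathbb R^n)$ are a pair of coupled quasi-upper and quasi-lower solutions of the wave equation $$\varphi'(t)-\frac{D}{c^2}\varphi''(t)=\mathbf f(\varphi(t),\varphi(t-\tau)),\quad t\in\mathbb R, \qquad (W)$$ and that $$\lim_{t\to-\infty}\tilde\varphi(t)=0,\qquad \lim_{t\to+\infty}\hat\varphi(t)=\mathbf K .$$ Then (W) together with the boundary conditions $\lim_{t\to-\infty}\varphi(t)=0$, $\lim_{t\to+\infty}\varphi(t)=\mathbf K$ admits a solution $\varphi$. That is, the system $$\frac{\partial}{\partial t}\mathbf u(x,t)-D\frac{\partial^2}{\partial x^2}\mathbf u(x,t)=\mathbf f(\mathbf u,\mathbf u_\tau),\quad x\in\mathbb R,$$ has a traveling wave solution $\mathbf u(x,t)=\varphi(t+x/c)$.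
   Context: Setting: $n\ge 1$, $D=\mathrm{diag}(d_1,\dots,d_n)$ with $d_i>0$, $c>0$ is a constant (wave speed), $\tau=(\tau_1,\dots,\tau_n)$ with positive constants $\tau_i$ (discrete delays), $\mathbf f=(f_1,\dots,f_n):\mathbb R^n\times\mathbb R^n\to\mathbb R^n$ is Lipschitz continuous, and $\mathbf K=(K_1,\dots,K_n)$ with all $K_i>0$. In the PDE, $\mathbf u_\tau(x,t)=(u_1(x,t-\tau_1),\dots,u_n(x,t-\tau_n))$. For a function $\varphi:\mathbb R\to\mathbb R^n$, $\varphi_\tau(t)=\varphi(t-\tau)=(\varphi_1(t-\tau_1),\dots,\varphi_n(t-\tau_n))$. Inequalities between vectors are componentwise. $\mathcal C_b(\mathbb R,\mathbb R^n)$ is the space of bounded continuous functions, $\mathcal C_b^k(\mathbb R,\mathbb R^n)$ the space of functions with continuous bounded derivatives up to order $k$, and $\mathcal C_{[0,\mathbf K]}(\mathbb R,\mathbb R^n)=\{\varphi\in\mathcal C_b(\mathbb R,\mathbb R^n): 0\le\varphi_i(t)\le K_i \text{ for all } t\in\mathbb R,\ i=1,\dots,n\}$. A traveling wave solution is a solution of the form $\mathbf u(x,t)=\varphi(t+x/c)$ with profile $\varphi\in\mathcal C_b^2(\mathbb R,\mathbb R^n)$ solving (W) and having limits at $\pm\infty$ (here $0$ at $-\infty$ and $\mathbf K$ at $+\infty$). Mixed quasimonotone property in $[0,\mathbf K]$: for each $i=1,\dots,n$ there exist nonnegative integers $a_i,b_i,c_i,d_i$ (here $d_i$ is an index count, not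 the diffusion coefficient) with $a_i+b_i=n-1$, $c_i+d_i=n$, and splittings $\mathbf u=(u_i,[\mathbf u]_{a_i},[\mathbf u]_{b_i})$, $\mathbf v=([\mathbf v]_{c_i},[\mathbf v]_{d_i})$ (where $[\mathbf u]_\sigma$ denotes a vector with $\sigma$ components of $\mathbf u$) such that, for arguments in $[0,\mathbf K]$, $f_i(\mathbf u,\mathbf v)=f_i(u_i,[\mathbf u]_{a_i},[\mathbf u]_{b_i},[\mathbf v]_{c_i},[\mathbf v]_{d_i})$ is nondecreasing in $[\mathbf u]_{a_i}$ and $[\mathbf v]_{c_i}$ and nonincreasing in $[\mathbf u]_{b_i}$ and $[\mathbf v]_{d_i}$. Coupled quasi-upper and quasi-lower solutions of (W): a pair $\tilde\varphi,\hat\varphi\in\mathcal C_b^1(\mathbb R,\mathbb R^n)$ with $\tilde\varphi\ge\hat\varphi$, whose second derivatives exist and are continuous and bounded on $\mathbb R\setminus\{0\}$ with one-sided limits as $t\to0^-$ and $t\to0^+$, and such that for all $i=1,\dots,n$ and all $t\in\mathbb R\setminus\{0\}$ (with $d_i$ the diffusion coefficient on the left), $$\tilde\varphi_i'-\tfrac{d_i}{c^2}\tilde\varphi_i''\ge f_i(\tilde\varphi_i,[\tilde\varphi]_{a_i},[\hat\varphi]_{b_i},[\tilde\varphi_\tau]_{c_i},[\hat\varphi_\tau]_{d_i}),$$ $$\hat\varphi_i'-\tfrac{d_i}{c^2}\hat\varphi_i''\le f_i(\hat\varphi_i,[\hat\varphi]_{a_i},[\tilde\varphi]_{b_i},[\hat\varphi_\tau]_{c_i},[\tilde\varphi_\tau]_{d_i}).$$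 *)

(* Defs.v *)
From mathcomp Require Import all_boot all_order all_algebra.
From mathcomp Require Import all_classical all_reals all_analysis.
Import Order.TTheory GRing.Theory Num.Theory numFieldNormedType.Exports.

Set Implicit Arguments.
Unset Strict Implicit.
Unset Printing Implicit Defensive.

Local Open Scope ring_scope.
Local Open Scope classical_set_scope.

(* Vectors of R^n are row vectors 'rV[R]_n with the sup norm; the i-th
   component of u is u 0 i.  The nonlinearity f(u, v) is a function of the
   pair (u, v) in the product normed space. *)

(* Finite-dimensional C^1: pointwise continuity of x |-> 'd f x v for each v
   is continuity of x |-> 'd f x in operator norm. *)
Definition C1_fun (R : realType) (V W : normedModType R) (f : V -> W) : Prop :=
  (forall x, differentiable f x) /\
  (forall v, continuous (fun x => 'd f x v)).

Definition Cb (R : realType) (n k : nat) (phi : R -> 'rV[R]_n) : Prop :=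
  (forall j, (j < k)%N -> forall t, derivable phi^`(j) t 1) /\
  (forall j, (j <= k)%N -> continuous phi^`(j) /\ bounded_fun phi^`(j)).

Definition in_box (R : realType) (n : nat) (K u : 'rV[R]_n) : Prop :=
  forall j, 0 <= u 0 j <= K 0 j.

Definition Cbox (R : realType) (n : nat) (K : 'rV[R]_n)
    (phi : R -> 'rV[R]_n) : Prop :=
  Cb 0 phi /\ forall t, in_box K (phi t).

(* phi_tau (t) = (phi_1 (t - tau_1), ..., phi_n (t - tau_n)) *)
Definition delay (R : realType) (n : nat) (tau : 'rV[R]_n)
    (phi : R -> 'rV[R]_n) (t : R) : 'rV[R]_n :=
  \row_j phi (t - tau 0 j) 0 j.

(* For every i, the index sets of [u]_{a_i}, [u]_{b_i}, [v]_{c_i}, [v]_{d_i};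
   the counts a_i, b_i, c_i, d_i are their cardinals, so that
   a_i + b_i = n - 1 and c_i + d_i = n. *)
Record splitting (n : nat) := Splitting {
  ua : 'I_n -> {set 'I_n};
  ub : 'I_n -> {set 'I_n};
  vc : 'I_n -> {set 'I_n};
  vd : 'I_n -> {set 'I_n};
  uab_disjoint : forall i, ua i :&: ub i = finset.set0;
  uab_cover : forall i, ua i :|: ub i = [set~ i]%SET;
  vcd_disjoint : forall i, vc i :&: vd i = finset.set0;
  vcd_cover : forall i, vc i :|: vd i = [set: 'I_n]%SET
}.

Definition le_along (R : realType) (n : nat) (S : {set 'I_n})
    (u u' : 'rV[R]_n) : Prop :=
  (forall j, j \in S -> u 0 j <= u' 0 j) /\
  (forall j, j \notin S -> u 0 j = u' 0 j).

Definition mixed_quasimonotone (R : realType) (n : nat) (K : 'rV[R]_n)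
    (s : splitting n) (f : 'rV[R]_n * 'rV[R]_n -> 'rV[R]_n) : Prop :=
  forall i : 'I_n,
  [/\ (forall u u' v, in_box K u -> in_box K u' -> in_box K v ->
         le_along (ua s i) u u' -> f (u, v) 0 i <= f (u', v) 0 i),
      (forall u u' v, in_box K u -> in_box K u' -> in_box K v ->
         le_along (ub s i) u u' -> f (u', v) 0 i <= f (u, v) 0 i),
      (forall u v v', in_box K u -> in_box K v -> in_box K v' ->
         le_along (vc s i) v v' -> f (u, v) 0 i <= f (u, v') 0 i)
    & (forall u v v', in_box K u -> in_box K v -> in_box K v' ->
         le_along (vd s i) v v' -> f (u, v') 0 i <= f (u, v) 0 i)].

(* the vector ([p]_S, [q]_{~S}) *)
Definition merge (R : realType) (n : nat) (S : {set 'I_n})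
    (p q : 'rV[R]_n) : 'rV[R]_n :=
  \row_j (if j \in S then p 0 j else q 0 j).

(* f_i (p_i, [p]_{a_i}, [q]_{b_i}, [p']_{c_i}, [q']_{d_i}) *)
Definition mixed_arg (R : realType) (n : nat) (s : splitting n)
    (f : 'rV[R]_n * 'rV[R]_n -> 'rV[R]_n) (i : 'I_n)
    (p q p' q' : 'rV[R]_n) : R :=
  f (merge (i |: ua s i)%SET p q, merge (vc s i) p' q') 0 i.

(* i-th component of phi' - (D / c^2) phi'', D = diag(d_1, ..., d_n) *)
Definition wave_op (R : realType) (n : nat) (d : 'rV[R]_n) (c : R)
    (phi : R -> 'rV[R]_n) (i : 'I_n) (t : R) : R :=
  phi^`()%classic t 0 i - d 0 i / c ^+ 2 * phi^`(2)%classic t 0 i.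

(* Since phi^`(2) is total, its value at 0 is meaningless here and every
   condition below avoids it (0^'- and 0^'+ are punctured). *)
Definition quasi_regular (R : realType) (n : nat)
    (phi : R -> 'rV[R]_n) : Prop :=
  [/\ Cb 1 phi,
      (forall t, t != 0 ->
         derivable phi^`() t 1 /\ {for t, continuous phi^`(2)}),
      [bounded phi^`(2) t | t in [set t : R | t != 0]],
      (exists l : 'rV[R]_n, phi^`(2) t @[t --> 0^'-] --> l)
    & (exists l : 'rV[R]_n, phi^`(2) t @[t --> 0^'+] --> l)].

Definition coupled_quasi_solutions (R : realType) (n : nat)
    (d tau : 'rV[R]_n) (c : R) (s : splitting n)
    (f : 'rV[R]_n * 'rV[R]_n -> 'rV[R]_n)
    (upper lower : R -> 'rV[R]_n) : Prop :=
  [/\ quasi_regular upper,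
      quasi_regular lower,
      (forall t j, lower t 0 j <= upper t 0 j),
      (forall i t, t != 0 ->
         mixed_arg s f i (upper t) (lower t)
           (delay tau upper t) (delay tau lower t) <= wave_op d c upper i t)
    & (forall i t, t != 0 ->
         wave_op d c lower i t <=
         mixed_arg s f i (lower t) (upper t)
           (delay tau lower t) (delay tau upper t))].

Definition solves_wave_eq (R : realType) (n : nat) (d tau : 'rV[R]_n) (c : R)
    (f : 'rV[R]_n * 'rV[R]_n -> 'rV[R]_n) (phi : R -> 'rV[R]_n) : Prop :=
  forall i t, wave_op d c phi i t = f (phi t, delay tau phi t) 0 i.

Definition solves_pde (R : realType) (n : nat) (d tau : 'rV[R]_n)
    (f : 'rV[R]_n * 'rV[R]_n -> 'rV[R]_n) (u : R -> R -> 'rV[R]_n) : Prop :=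
  forall x t,
  [/\ derivable (fun r => u x r) t 1,
      derivable (fun y => u y t) x 1,
      derivable (fun y => u y t)^`() x 1
    & forall i, (fun r => u x r)^`()%classic t 0 i
                - d 0 i * (fun y => u y t)^`(2)%classic x 0 i
                = f (u x t, delay tau (fun r => u x r) t) 0 i].

(* Main.v *)
Require Import Defs.
From mathcomp Require Import all_boot all_order all_algebra.
From mathcomp Require Import all_classical all_reals all_analysis.
From mathcomp Require Import ring lra.
Import Order.TTheory GRing.Theory Num.Theory numFieldNormedType.Exports.

(** A wave profile is a fixed point of an integral-type operator.  With
    [al i = d i / c ^ 2] and a Lipschitz constant [L] of [f], the wave equation reads
    [- al i w'' + w' + L w = rhs phi i] with [w = phi i], where
    [rhs phi i = L phi i + f i (phi, phi_tau)].  The left-hand side factors into two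
    first-order operators [D - p] and [D + q] with [p, q > 0].  So for bounded
    [rhs phi i] the linear equation has exactly one bounded solution
    ([second_order_solution]), and it obeys a maximum principle
    ([second_order_comparison]) that tolerates a jump of the second derivative at
    the origin.  Mixed quasimonotonicity, with the term [L phi i] absorbing the
    dependence of [f i] on the [i]-th entry, shows that the operator [phi |-> w] maps
    the set of profiles between [lower] and [upper] to itself ([solution_between]).

    A fixed point comes from a hands-on version of Schauder's theorem.  A profile
    is encoded by its values at finitely many points, which turns the operator into
    a Lipschitz self-map of a finite-dimensional cube; this map has approximate fixed
    points ([approximate_fixed_point]) by Kuhn's combinatorial lemma
    ([bichromatic_cube]), proved here by adding up mod 2 cup products over a grid.
    The resulting approximate profiles are bounded together with their first and
    second derivatives, and the latter are uniformly Lipschitz, so they converge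
    pointwise along an ultrafilter to an exact solution ([profile_exists]).

    The limits at infinity then follow by squeezing: the solution lies above
    [lower], which is nonnegative and tends to [K] at +oo, and below [upper], which
    is at most [K] and tends to [0] at -oo. *)

Set Implicit Arguments.
Unset Strict Implicit.
Unset Printing Implicit Defensive.

(** * Mod 2 cup products on a grid and Kuhn's lemma *)

Section cubical_cochains.
Variable I : finType.
Variable lam : I -> (I -> nat) -> bool.
Implicit Types (x y : I -> nat) (l : (I -> nat) -> bool) (S : {set I}).

Definition upd x (j : I) (a : nat) : I -> nat :=
  fun i => if i == j then a else x i.

Definition incr x j := upd x j (x j).+1.

Definition diff j l x := l (incr x j) (+) l x.

(** The mod 2 cubical cup product of the coboundaries of the labels [lam h],
    [h] in [s], evaluated on the cube with lowest corner [x] and directions [S]: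
    a sum, over the monotone edge paths that leave [x] and use each direction
    once, of the product of the increments of the successive labels. *)
Fixpoint cup (s : seq I) S x : bool :=
  if s is h :: s' then
    \big[addb/false]_(j in S) (diff j (lam h) x && cup s' (S :\ j) (incr x j))
  else true.

Lemma upd_comm x i j a b : i != j -> upd (upd x i a) j b = upd (upd x j b) i a.
Proof.
move=> ij; apply: funext => m; rewrite /upd.
by case: (m =P j) => // ->; rewrite eq_sym (negbTE ij).
Qed.

Lemma incr_comm x i j : incr (incr x i) j = incr (incr x j) i.
Proof.
have [->//|ij] := eqVneq i j.
have E a b : a != b -> incr (incr x a) b = upd (upd x a (x a).+1) b (x b).+1.
  by move=> ab; rewrite /incr [upd x a _ b]/upd eq_sym (negbTE ab).
by rewrite (E i j ij) (E j i) 1?eq_sym // upd_comm.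
Qed.

Lemma exchange_pairs S (F : I -> I -> bool) :
    \big[addb/false]_(j in S) \big[addb/false]_(i in S :\ j) F i j
  = \big[addb/false]_(j in S) \big[addb/false]_(i in S :\ j) F j i.
Proof.
rewrite (exchange_big_dep (mem S)) /=; last by move=> j i _ /setD1P[].
apply: eq_bigr => i iS; apply: eq_bigl => j.
by rewrite !inE andbC eq_sym; case: (i == j); rewrite ?iS ?andbT ?andbF.
Qed.

Lemma split_pairs S (F G : I -> I -> bool) :
    \big[addb/false]_(j in S) \big[addb/false]_(i in S :\ j) (F i j (+) G i j)
  = \big[addb/false]_(j in S) \big[addb/false]_(i in S :\ j) F i j (+)
    \big[addb/false]_(j in S) \big[addb/false]_(i in S :\ j) G i j.
Proof. by rewrite -big_split; apply: eq_bigr => j _; rewrite -big_split. Qed.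

(** Each unordered pair is counted twice. *)
Lemma symmetric_pairs S (T : I -> I -> bool) : (forall i j, T i j = T j i) ->
  \big[addb/false]_(j in S) \big[addb/false]_(i in S :\ j) T i j = false.
Proof.
move=> symT; pose A i j := (enum_rank i < enum_rank j) && T i j.
transitivity (\big[addb/false]_(j in S) \big[addb/false]_(i in S :\ j)
    (A i j (+) A j i)).
  apply: eq_bigr => j _; apply: eq_bigr => i; rewrite !inE => /andP[ij _].
  rewrite /A (symT j i); case: ltngtP => //=; rewrite ?addbF //.
  by move=> /val_inj/enum_rank_inj E; rewrite E eqxx in ij.
by rewrite split_pairs exchange_pairs addbb.
Qed.

(** A cup product of coboundaries is a cocycle.  Splitting off the first label
    [l] leaves two double sums over pairs of directions: [T], symmetric because
    the mixed second difference of [l] is, hence zero mod 2; and [U], which for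
    each [i] contains the same statement for the remaining labels. *)
Lemma cup_closed s S x :
  \big[addb/false]_(j in S) diff j (cup s (S :\ j)) x = false.
Proof.
elim: s S x => [|h s IH] S x; first by rewrite big1.
have D2 i j : S :\ j :\ i = S :\ i :\ j by rewrite !finset.setDDl finset.setUC.
pose P i j := cup s (S :\ i :\ j) (incr (incr x i) j).
have symP i j : P i j = P j i by rewrite /P incr_comm D2.
pose l := lam h.
pose T i j := (diff i l (incr x j) (+) diff i l x) && P i j.
pose U i j := diff i l x && diff j (cup s (S :\ i :\ j)) (incr x i).
transitivity (\big[addb/false]_(j in S) \big[addb/false]_(i in S :\ j)
    (T i j (+) U i j)).
  apply: eq_bigr => j jS; rewrite {1}/diff /= -big_split /=.
  apply: eq_bigr => i _; rewrite /T /U -/l {6}/diff D2 (incr_comm x j i) -/(P i j).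
  by move: (diff _ _ _) (diff _ _ _) (P _ _) (cup _ _ _) => [] [] [] [].
rewrite split_pairs symmetric_pairs /=; last first.
  move=> i j; rewrite /T symP /diff incr_comm; congr (_ && _).
  by move: (l _) (l _) (l _) (l _) => [] [] [] [].
rewrite exchange_pairs big1 // => i iS.
by rewrite /U -big_distrr IH /= andbF.
Qed.

(** Since the remaining factor is a cocycle, the product rule makes the cup
    product a coboundary, whose sum over a box reduces to the faces. *)
Lemma cup_exact h s S x :
  cup (h :: s) S x =
  \big[addb/false]_(j in S) diff j (fun y => lam h y && cup s (S :\ j) y) x.
Proof.
transitivity (\big[addb/false]_(j in S)
   (diff j (fun y => lam h y && cup s (S :\ j) y) x (+)
    lam h x && diff j (cup s (S :\ j)) x)).
  rewrite /=; apply: eq_bigr => j _; rewrite /diff.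
  by move: (lam _ _) (lam _ _) (cup _ _ _) (cup _ _ _) => [] [] [] [].
by rewrite big_split -big_distrr cup_closed /= andbF addbF.
Qed.

(** On a face orthogonal to [j] where [lam j] is constant, the factor of the
    label [lam j] vanishes along every edge path. *)
Lemma cup_degenerate s S x j : j \notin S -> j \in s ->
  (forall i y, i \in S -> y j = x j -> diff i (lam j) y = false) ->
  cup s S x = false.
Proof.
elim: s S x => [//|h s IH] S x jS js dj /=; apply: big1 => i iS.
move: js; rewrite inE => /predU1P[<-|js]; first by rewrite dj.
have ij : j != i by apply: contraNneq jS => ->.
rewrite IH ?andbF //; first by rewrite !inE (negbTE jS) andbF.
move=> m y /setD1P[_ mS] yj; apply: dj => //.
by rewrite yj /incr /upd (negbTE ij).
Qed.

(** A nonzero cup product has a path along which every label changes. *)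
Lemma cup_cube s S x h : cup s S x -> h \in s ->
  exists y z, [/\ forall i, x i <= y i <= x i + (i \in S),
                  forall i, x i <= z i <= x i + (i \in S)
                & lam h y != lam h z].
Proof.
elim: s S x => [//|m s IH] S x cS hs.
have [/existsP[i /and3P[iS di ci]]|] := boolP [exists i, [&& i \in S,
   diff i (lam m) x & cup s (S :\ i) (incr x i)]]; last first.
  rewrite negb_exists => /forallP H; move: cS; rewrite /= big1 // => i iS.
  by have := H i; rewrite iS /= => /negbTE.
have leq_incr j : x j <= incr x i j <= x j + (j \in S).
  rewrite /incr /upd; case: eqP => [->|_]; last by rewrite leqnn leq_addr.
  by rewrite iS addn1 leqnSn leqnn.
move: hs; rewrite inE => /predU1P[->|hs].
  exists (incr x i), x; split => //.
  - by move=> j; rewrite leqnn leq_addr.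
  - by move: di; rewrite /diff; case: (lam m _) (lam m _) => [] [].
have [y [z [hy hz yz]]] := IH _ _ ci hs.
have le_cube w : (forall j, incr x i j <= w j <= incr x i j + (j \in S :\ i)) ->
    forall j, x j <= w j <= x j + (j \in S).
  move=> hw j; have /andP[h1 h2] := hw j.
  have /andP[h3 h4] := leq_incr j; rewrite (leq_trans h3 h1) /=.
  rewrite (leq_trans h2) // /incr /upd !inE.
  by case: eqP => [->|_] /=; rewrite ?iS ?addn0 ?addn1.
by exists y, z; split=> //; exact: le_cube.
Qed.

Variable k : nat.

Fixpoint box_sum (s : seq I) (g : (I -> nat) -> bool) x : bool :=
  if s is j :: s' then
    box_sum s' (fun y => \big[addb/false]_(a < k) g (upd y j a)) x
  else g x.

Lemma box_sum_big s (J : finType) (P : pred J) (F : J -> (I -> nat) -> bool) x :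
  box_sum s (fun y => \big[addb/false]_(j | P j) F j y) x =
  \big[addb/false]_(j | P j) box_sum s (F j) x.
Proof.
elim: s F => [//|i s IH] F /=; rewrite -IH; congr box_sum.
by apply: funext => y; rewrite exchange_big.
Qed.

Lemma box_sum0 s x : box_sum s (fun=> false) x = false.
Proof.
elim: s => [//|i s IH] /=; rewrite -[RHS]IH; congr box_sum.
by apply: funext => y; rewrite big1.
Qed.

Lemma box_sum_rem s j g x : uniq s -> j \in s ->
  box_sum s g x =
  box_sum (rem j s) (fun y => \big[addb/false]_(a < k) g (upd y j a)) x.
Proof.
elim: s g => [//|i s IH] g /= /andP[si us]; rewrite inE eq_sym.
case: eqVneq => [->//|ij /= js]; rewrite IH //=; congr box_sum.
apply: funext => y; rewrite exchange_big; apply: eq_bigr => a _.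
by apply: eq_bigr => b _; rewrite upd_comm // eq_sym.
Qed.

Lemma box_sum_upd s j a g x : j \notin s ->
  box_sum s (fun y => g (upd y j a)) x = box_sum s g (upd x j a).
Proof.
elim: s g => [//|i s IH] g /=; rewrite inE negb_or => /andP[ji js].
rewrite -IH //; congr box_sum; apply: funext => y; apply: eq_bigr => b _.
by rewrite upd_comm // eq_sym.
Qed.

Lemma telescope_diff j g y :
  \big[addb/false]_(a < k) diff j g (upd y j a) =
  g (upd y j k) (+) g (upd y j 0).
Proof.
have updd a b : upd (upd y j a) j b = upd y j b.
  by apply: funext => i; rewrite /upd; case: eqP.
elim: k => [|m IH]; first by rewrite big_ord0 addbb.
have E : upd y j m j = m by rewrite /upd eqxx.
rewrite big_ord_recr /= IH /diff /incr updd E.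
by move: (g _) (g _) (g _) => [] [] [].
Qed.

Lemma box_sum_exists s g x : uniq s -> box_sum s g x ->
  exists2 y, g y & forall i, i \in s -> y i < k.
Proof.
elim: s g x => [|j s IH] g x /=; first by exists x.
case/andP => js us /(IH _ _ us)[y gy ys].
have [/existsP[a ga]|] := boolP [exists a : 'I_k, g (upd y j a)]; last first.
  rewrite negb_exists => /forallP H; move: gy; rewrite big1 // => a _.
  exact: negbTE.
exists (upd y j a) => // i; rewrite inE /upd.
by case: eqP => [_ _|_ /= /ys].
Qed.

(** By [cup_exact] the sum telescopes to the faces of the box.  On the faces
    orthogonal to [j != h] the label [lam j] is constant, so they contribute
    nothing; of the two faces orthogonal to [h], only the one where [lam h]
    holds remains, and it carries the same sum for the remaining labels. *)
Lemma box_sum_cup s x : uniq s ->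
  (forall i y, i \in s -> y i = 0 -> lam i y = false) ->
  (forall i y, i \in s -> y i = k -> lam i y) ->
  box_sum s (cup s [set i in s]) x.
Proof.
elim: s x => [//|h s IH] x us lam0 lamk.
have lam_diff i j (y : I -> nat) : j \in h :: s -> i != j -> y j = 0 \/ y j = k ->
    diff i (lam j) y = false.
  move=> js ij yj; have E : incr y i j = y j.
    by rewrite /incr /upd eq_sym (negbTE ij).
  by case: yj => yj; [rewrite /diff !lam0|rewrite /diff !lamk]; rewrite ?E.
set S := [set i in h :: s].
have -> : cup (h :: s) S = fun y =>
    \big[addb/false]_(j in S) diff j (fun y => lam h y && cup s (S :\ j) y) y.
  by apply: funext => y; rewrite cup_exact.
rewrite box_sum_big (bigD1 h) ?inE ?eqxx // big1 ?addbF; last first.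
  move=> j /andP[jS jh]; have js : j \in h :: s by move: jS; rewrite /S finset.in_set.
  rewrite (@box_sum_rem _ j) // -[RHS](box_sum0 (rem j (h :: s)) x).
  congr box_sum; apply: funext => y; rewrite telescope_diff.
  have js' : j \in s by move: js; rewrite inE (negbTE jh).
  rewrite !(@cup_degenerate s (S :\ j) _ j) ?andbF // ?inE ?eqxx //.
    move=> i z; rewrite !inE => /andP[ij _] zj; apply: lam_diff => //.
    by left; rewrite zj /upd eqxx.
  move=> i z; rewrite !inE => /andP[ij _] zj; apply: lam_diff => //.
  by right; rewrite zj /upd eqxx.
have /andP[hs us'] := us.
have -> : S :\ h = [set i in s].
  apply/setP => i; rewrite !inE; case: eqP => [->|//].
  by rewrite (negbTE hs).
rewrite (@box_sum_rem _ h) ?mem_head // [rem h _]/= eqxx.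
have -> : (fun y => \big[addb/false]_(a < k)
      diff h (fun y0 => lam h y0 && cup s [set i in s] y0) (upd y h a)) =
    fun y => cup s [set i in s] (upd y h k).
  apply: funext => y; rewrite telescope_diff.
  have E a : upd y h a h = a by rewrite /upd eqxx.
  by rewrite lamk ?mem_head // ?lam0 ?mem_head //= addbF.
rewrite box_sum_upd // -[X in is_true X]/(_ (+) false) addbF.
by apply: IH => // i y si; [apply: lam0|apply: lamk]; rewrite inE si orbT.
Qed.

(** Kuhn's cubical form of Sperner's lemma: the cup products of the cubes of the
    box add up to one mod 2, so one of them is nonzero, and each label takes both
    values at the vertices of that cube. *)
Lemma bichromatic_cube :
  (forall i y, y i = 0 -> lam i y = false) ->
  (forall i y, y i = k -> lam i y) ->
  exists2 x, forall i, x i < k &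
    forall h, exists y z, [/\ forall i, x i <= y i <= (x i).+1,
      forall i, x i <= z i <= (x i).+1, lam h y = false & lam h z].
Proof.
move=> lam0 lamk.
have [x cx xk] := box_sum_exists (enum_uniq I)
  (box_sum_cup (fun=> 0) (enum_uniq I) (fun i y _ => @lam0 i y)
    (fun i y _ => @lamk i y)).
exists x => [i|h]; first by apply: xk; rewrite mem_enum.
have [y [z [yx zx yz]]] := cup_cube cx (mem_enum I h).
have hS i : (i \in [set i in enum I]) = true by rewrite inE mem_enum.
have {}yx i : x i <= y i <= (x i).+1 by have := yx i; rewrite hS addn1.
have {}zx i : x i <= z i <= (x i).+1 by have := zx i; rewrite hS addn1.
case Ey: (lam h y) yz; case Ez: (lam h z) => // _; first by exists z, y.
by exists y, z.
Qed.

End cubical_cochains.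

Local Open Scope ring_scope.

(** * Approximate fixed points of Lipschitz maps of a cube *)

(** Brouwer's theorem, in the approximate form that suffices here.  Label a grid
    point in direction [i] according to whether [g] moves it down in that
    direction.  In the cube given by [bichromatic_cube], whose vertices are
    [del]-close to each other, every coordinate is moved both up and down, so by
    the Lipschitz condition it is hardly moved at all. *)
Lemma approximate_fixed_point (R : realType) (I : finType) (a L : R)
    (g : (I -> R) -> I -> R) :
  0 < a -> 0 <= L ->
  (forall x y (del : R), (forall i, `|x i - y i| <= del) ->
     forall i, `|g x i - g y i| <= L * del) ->
  (forall x i, 0 <= g x i <= a) ->
  forall e : R, 0 < e -> exists x, forall i, `|g x i - x i| <= e.
Proof.
move=> a0 L0 gL gbox e e0.
pose k := (Num.truncn ((L + 1) * a / e)).+1.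
have k0 : 0 < k%:R :> R by rewrite ltr0n.
pose del : R := a / k%:R.
have del0 : 0 <= del by rewrite divr_ge0 // ltW.
have dele : (L + 1) * del <= e.
  rewrite /del mulrA ler_pdivrMr // [e * _]mulrC -ler_pdivrMr //.
  by apply: ltW; exact: truncnS_gt.
pose pt (p : I -> nat) i : R := (p i)%:R * del.
(* On the face [p i = k] the label is forced to hold; there [g] cannot move the
   point up, so a true label still means that the point is not moved up. *)
pose lam i p := (0 < p i)%N && ((k <= p i)%N || (g (pt p) i < pt p i)).
have [] := @bichromatic_cube I lam k.
- by move=> i p pi0; rewrite /lam pi0.
- by move=> i p pik; rewrite /lam pik leqnn.
move=> x _ xP; exists (pt x) => h.
have near_x y : (forall i, x i <= y i <= (x i).+1)%N ->
    (forall i, pt x i <= pt y i <= pt x i + del) /\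
    `|g (pt x) h - g (pt y) h| <= L * del.
  move=> xy; have near i : pt x i <= pt y i <= pt x i + del.
    have /andP[h1 h2] := xy i; rewrite /pt ler_wpM2r ?ler_nat //=.
    by rewrite -[X in _ + X]mul1r -mulrDl natr1 ler_wpM2r // ler_nat.
  split=> //; apply: gL => i; have /andP[h1 h2] := near i.
  by rewrite ler_distl; apply/andP; split; lra.
have [y [z [/near_x[xy gy] /near_x[xz gz] ly lz]]] := xP h.
have hy : pt y h <= g (pt y) h.
  move: ly; rewrite /lam; case: posnP => [y0 _|_ /=].
    by rewrite /pt y0 mul0r; have /andP[] := gbox (pt y) h.
  by move/negbT; rewrite negb_or -leNgt => /andP[].
have hz : g (pt z) h <= pt z h.
  case/andP: lz => _ /orP[kz|/ltW//].
  apply: (@le_trans _ _ a); first by have /andP[] := gbox (pt z) h.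
  rewrite /pt /del mulrA ler_pdivlMr // mulrC ler_wpM2r ?(ltW a0) //.
  by rewrite ler_nat.
have /andP[? ?] := xy h; have /andP[? ?] := xz h.
move: gy gz; rewrite !ler_distl => /andP[? ?] /andP[? ?].
by apply/andP; split; nra.
Qed.

Local Open Scope classical_set_scope.

(** * First-order linear equations on the line *)

Section calculus.
Variable R : realType.
Implicit Types (f g u w : R -> R) (a b s t la : R).

Lemma is_derive_mul f g t a b : is_derive t 1 f a -> is_derive t 1 g b ->
  is_derive t 1 (fun s => f s * g s) (a * g t + f t * b).
Proof.
move=> df dg; have := is_deriveM df dg => H.
by apply: (is_derive_eq H); rewrite addrC mulrC.
Qed.

Lemma is_derive_comb f g t a b p q : is_derive t 1 f a -> is_derive t 1 g b ->
  is_derive t 1 (fun s => p * f s + q * g s) (p * a + q * b).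
Proof.
move=> df dg.
have /= Hp := is_derive_mul (is_derive_cst p t 1) df.
have /= Hq := is_derive_mul (is_derive_cst q t 1) dg.
by apply: (is_derive_eq (is_deriveD Hp Hq)); rewrite /= !mul0r !add0r.
Qed.

Lemma is_derive_comp_affine f p q t a : is_derive (p * t + q) 1 f a ->
  is_derive t 1 (fun s => f (p * s + q)) (a * p).
Proof.
move=> df; have dl : is_derive t 1 (fun s => p * s + q) p.
  have := is_derive_comb p 1 (is_derive_id t 1) (is_derive_cst q t 1).
  rewrite /= mulr0 addr0 mulr1; congr is_derive.
  by apply: funext => s /=; rewrite mul1r.
exact: (@is_derive1_comp R f (fun s => p * s + q) t a p df dl).
Qed.

Lemma is_derive_expRM la t :
  is_derive t 1 (fun s => expR (la * s)) (la * expR (la * t)).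
Proof.
have H : is_derive (la * t + 0) 1 expR (expR (la * t)).
  by rewrite addr0; exact: is_derive_expR.
have := is_derive_comp_affine H; rewrite mulrC; congr is_derive.
by apply: funext => s /=; rewrite addr0.
Qed.

Lemma is_derive_continuous f t a : is_derive t 1 f a -> {for t, continuous f}.
Proof.
by move=> [df _]; apply: differentiable_continuous; exact/derivable1_diffP.
Qed.

Lemma is_derive_all_continuous f g : (forall t, is_derive t 1 f (g t)) ->
  continuous f.
Proof. by move=> df t; exact: is_derive_continuous (df t). Qed.

Lemma bounded_derive_lipschitz f df (C : R) : (forall t, is_derive t 1 f (df t)) ->
  (forall t, `|df t| <= C) -> forall s t, `|f s - f t| <= C * `|s - t|.
Proof.
move=> dff dfC; suff H s t : s <= t -> `|f t - f s| <= C * `|t - s|.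
  move=> s t; case: (leP s t) => [/H|/ltW/H//].
  by rewrite distrC [X in C * X]distrC.
move=> st; have [c _ ->] := MVT_segment st (fun x _ => dff x)
  (continuous_subspaceT (is_derive_all_continuous dff)).
by rewrite normrM ler_wpM2r.
Qed.

(** The derivative of a quasi-solution may have a corner at the origin;
    continuity is enough to glue the monotonicity on the two half-lines. *)
Lemma nondecreasing_off0 u du : continuous u ->
  (forall t, t != 0 -> is_derive t 1 u (du t)) ->
  (forall t, t != 0 -> 0 <= du t) -> forall s t, s <= t -> u s <= u t.
Proof.
move=> cu ddu du0.
have H s t : 0 \notin `]s, t[%R -> s <= t -> u s <= u t.
  move=> Nst; rewrite le_eqVlt => /predU1P[->//|st].
  have ne0 x : x \in `]s, t[%R -> x != 0 by move=> xst; apply: contraNneq Nst => <-.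
  have [x xst ux] := MVT st (fun x xst => ddu x (ne0 x xst))
     (continuous_subspaceT cu).
  by rewrite -subr_ge0 ux mulr_ge0 ?du0 ?ne0 // subr_ge0 ltW.
move=> s t st; have [|] := boolP (0 \in `]s, t[%R); last by move/H; apply.
rewrite in_itv /= => /andP[s0 t0]; apply: (@le_trans _ _ (u 0)).
  by apply: H; rewrite ?ltW // in_itv /= ltxx andbF.
by apply: H; rewrite ?ltW // in_itv /= ltxx.
Qed.

(** The function [expR (- la * t) * w t] is nonincreasing.  If [w] were negative
    at [t0], it would thus stay below [w t0 * expR (la * (t - t0))], and this is
    unbounded on the right. *)
Lemma first_order_comparison la w dw (C : R) : 0 < la -> continuous w ->
  (forall t, `|w t| <= C) ->
  (forall t, t != 0 -> is_derive t 1 w (dw t)) ->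
  (forall t, t != 0 -> dw t <= la * w t) -> forall t, 0 <= w t.
Proof.
move=> la0 cw wC ddw dw_le t0; rewrite leNgt; apply/negP => wt0.
pose u t := - (expR (- la * t) * w t).
have mono s t : s <= t -> u s <= u t.
  apply: (@nondecreasing_off0 u
    (fun t => - (- la * expR (- la * t) * w t + expR (- la * t) * dw t))).
  - move=> x; apply: cvgN; apply: cvgM; last exact: cw.
    exact: is_derive_continuous (is_derive_expRM _ _).
  - move=> x x0; apply: is_deriveN.
    by apply: is_derive_mul; [exact: is_derive_expRM|exact: ddw].
  - move=> x x0; have := dw_le _ x0; have := expR_gt0 (- la * x).
    by move: (expR _) => e e0 ?; nra.
(* By [1 + x <= expR x], the time [h] is enough to leave the bound [C]. *)
pose h := C / (la * - w t0); pose t := t0 + h.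
have C0 : 0 <= C := le_trans (normr_ge0 _) (wC t0).
have h0 : 0 <= h by rewrite divr_ge0 // mulr_ge0 ?ltW // oppr_gt0.
have : u t0 <= u t by apply: mono; rewrite /t lerDl.
rewrite /u lerN2 => H.
have E : expR (- la * t0) = expR (- la * t) * expR (la * h).
  by rewrite -expRD; congr expR; rewrite /t; ring.
move: H; rewrite E -mulrA ler_pM2l ?expR_gt0 // => H.
have := wC t; rewrite ler_norml => /andP[HC _].
have wn0 : w t0 != 0 by rewrite lt_eqF.
have Eh : la * h * - w t0 = C.
  by rewrite /h; field; rewrite wn0 gt_eqF.
have := expR_ge1Dx (la * h); move: H Eh; move: (la * h) => z; move: (expR z) => e H Eh He.
nra.
Qed.

Lemma first_order_comparison_neg la w dw (C : R) : 0 < la -> continuous w ->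
  (forall t, `|w t| <= C) ->
  (forall t, t != 0 -> is_derive t 1 w (dw t)) ->
  (forall t, t != 0 -> - la * w t <= dw t) -> forall t, 0 <= w t.
Proof.
move=> la0 cw wC ddw dw_le t; rewrite -(opprK t).
apply: (@first_order_comparison la (fun s => w (- s)) (fun s => - dw (- s)) C) => //.
- by move=> s; apply: continuous_comp; [exact: opp_continuous|exact: cw].
- move=> s s0; have Ns0 : - s != 0 by rewrite oppr_eq0.
  have H : is_derive (-1 * s + 0) 1 w (dw (- s)).
    by rewrite mulN1r addr0; exact: ddw.
  have := is_derive_comp_affine H; rewrite mulrN1; congr is_derive.
  by apply: funext => x /=; rewrite mulN1r addr0.
- by move=> s s0; have := dw_le (- s); rewrite oppr_eq0 => /(_ s0); lra.
Qed.

(** The integrals from distinct base points [a < 0], normalized to vanish at the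
    origin, agree wherever they are both defined, so they glue together. *)
Lemma antiderivative_exists g : continuous g ->
  exists G : R -> R, forall t, is_derive t 1 G (g t).
Proof.
move=> cg; pose F a t := (\int[lebesgue_measure]_(x in [set` `[a, t]]) g x)%R.
have dF a t : a < t -> is_derive t 1 (F a) (g t).
  move=> a_t; have tt1 : t < t + 1 by rewrite ltrDl.
  have gi : lebesgue_measure.-integrable `[a, t + 1] (EFin \o g).
    apply: continuous_compact_integrable; first exact: segment_compact.
    exact: continuous_subspaceT.
  have [d e] := continuous_FTC1_closed tt1 gi a_t (cg t).
  by apply: DeriveDef => //; rewrite -derive1E.
pose H a t := F a t - F a 0.
have dH a t : a < t -> is_derive t 1 (H a) (g t).
  move=> /dF dFt; have := is_deriveB dFt (is_derive_cst (F a 0) t 1).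
  by rewrite subr0; apply.
have HE a b t : a < 0 -> b < 0 -> a < t -> b < t -> H a t = H b t.
  move=> a0 b0 a_t b_t.
  pose m := Num.min t 0; pose M := Num.max t 0.
  have mM : m <= M by rewrite /m /M ge_min le_max lexx.
  pose D s := 1 * H a s + (-1) * H b s.
  have dD x : m <= x -> is_derive x 1 D 0.
    move=> mx; have [ax bx] : a < x /\ b < x.
      by split; apply: lt_le_trans mx; rewrite /m lt_min ?a_t ?b_t.
    have := is_derive_comb 1 (-1) (dH a x ax) (dH b x bx).
    by rewrite mul1r mulN1r subrr.
  have dD1 x : x \in `]m, M[%R -> is_derive x 1 D 0.
    by rewrite in_itv => /andP[mx _]; apply: dD; exact: ltW.
  have dD2 : {within `[m, M], continuous D}.
    apply: derivable_within_continuous => x; rewrite in_itv => /andP[mx _].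
    by have [] := dD x mx.
  have [x _] := MVT_segment mM dD1 dD2; rewrite mul0r.
  have D0 : D 0 = 0 by rewrite /D /H !subrr !mulr0 addr0.
  suff : D M - D m = 0 -> D t = 0 by move=> h /h; rewrite /D; lra.
  by rewrite /M /m; case: (leP t 0) => _; rewrite D0; lra.
pose b t : R := - (`|t| + 1).
have b0 t : b t < 0 by rewrite /b oppr_lt0 ltr_wpDl.
have bt t : b t < t by have := ler_norm (- t); rewrite normrN /b; lra.
exists (fun t => H (b t) t) => t.
have bt1 : b t - 1 < t by rewrite ltrBlDr (lt_trans (bt t)) // ltrDl.
apply: near_eq_is_derive (dH (b t - 1) t bt1).
near=> s.
have b1 : b t - 1 < 0 by rewrite subr_lt0 (lt_trans (b0 t)).
apply: HE => //.
near: s; exact: lt_nbhsr.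
Unshelve. all: by end_near. Qed.

(** Variation of constants.  Let [G] be an antiderivative of
    [expR (la * s) * g s] and [c = C / la].  Then [P = G + c expR (la s)] is
    nondecreasing and [Q = G - c expR (la s)] is nonincreasing, with [Q <= P], so a
    constant [l] separates the values of [Q] from those of [P].  It stands for
    the limit of [G] at -oo, and [expR (- la t) (G t - l)] is bounded by [c]. *)
Lemma first_order_solution la g (C : R) : 0 < la -> continuous g ->
  (forall t, `|g t| <= C) ->
  exists2 w : R -> R, forall t, is_derive t 1 w (- la * w t + g t) &
    forall t, `|w t| <= C / la.
Proof.
move=> la0 cg gC.
have [G dG] : exists G : R -> R, forall t, is_derive t 1 G (expR (la * t) * g t).
  apply: antiderivative_exists => t; apply: cvgM; last exact: cg.
  exact: is_derive_continuous (is_derive_expRM _ _).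
have ddE q t : is_derive t 1 (fun s => 1 * G s + q * expR (la * s))
    (1 * (expR (la * t) * g t) + q * (la * expR (la * t))).
  by apply: is_derive_comb => //; exact: is_derive_expRM.
pose c := C / la; have cla : c * la = C by rewrite /c divfK // gt_eqF.
pose P s := 1 * G s + c * expR (la * s).
pose Q s := 1 * G s + (- c) * expR (la * s).
have gCC t : - C <= g t <= C by rewrite -ler_norml.
have C0 : 0 <= C := le_trans (normr_ge0 _) (gC 0).
have c0 : 0 <= c by rewrite divr_ge0 // ltW.
have monoP s t : s <= t -> P s <= P t.
  apply: (nondecreasing_off0 (is_derive_all_continuous (ddE c))) => x _ //.
  by have := expR_gt0 (la * x); have /andP[] := gCC x; nra.
have monoQ s t : s <= t -> Q t <= Q s.
  move=> st; rewrite -lerN2; move: s t st.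
  apply: (@nondecreasing_off0 (fun x => - Q x)
     (fun t => - (1 * (expR (la * t) * g t) + - c * (la * expR (la * t))))) => x.
  - by apply: cvgN; exact: (is_derive_all_continuous (ddE (- c))).
  - by move=> _; have := expR_gt0 (la * x); have /andP[] := gCC x; nra.
have QP s t : Q s <= P t.
  have QPs x : Q x <= P x.
    by rewrite /Q /P lerD2l ler_wpM2r ?expR_ge0 //; lra.
  case: (leP s t) => [st|/ltW ts]; first exact: le_trans (QPs s) (monoP _ _ st).
  exact: le_trans (monoQ _ _ ts) (QPs t).
pose l := inf (range P).
have lP t : l <= P t by apply: ge_inf; [exists (Q 0) => _ [s _ <-]|exists t].
have Ql t : Q t <= l.
  by apply: lb_le_inf; [exists (P 0), 0|move=> _ [s _ <-]].
exists (fun t => expR (- la * t) * (1 * G t + (- l) * 1)) => t.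
  apply: (is_derive_eq (is_derive_mul (is_derive_expRM (- la) t)
    (is_derive_comb 1 (- l) (dG t) (is_derive_cst (1 : R) t 1)))).
  have : expR (- la * t) * expR (la * t) = 1.
    by rewrite -expRD mulNr addNr expR0.
  move: (expR _) (expR _) => a b ab.
  by rewrite /cst -[X in _ = _ + X]mul1r -[X in _ = _ + X * _]ab; ring.
have E : expR (- la * t) * expR (la * t) = 1.
  by rewrite -expRD mulNr addNr expR0.
rewrite normrM (ger0_norm (expR_ge0 _)) -/c.
have -> : c = expR (- la * t) * (c * expR (la * t)) by rewrite mulrCA E mulr1.
rewrite ler_wpM2l ?expR_ge0 // ler_norml.
by have := lP t; have := Ql t; rewrite /P /Q => ? ?; apply/andP; split; lra.
Qed.

Lemma first_order_solution_pos la g (C : R) : 0 < la -> continuous g ->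
  (forall t, `|g t| <= C) ->
  exists2 w : R -> R, forall t, is_derive t 1 w (la * w t + g t) &
    forall t, `|w t| <= C / la.
Proof.
move=> la0 cg gC.
have [|t|w dw wC] := @first_order_solution la (fun s => - g (- s)) C la0.
- move=> t; apply: cvgN; apply: continuous_comp; last exact: cg.
  exact: opp_continuous.
- by rewrite normrN.
exists (fun s => w (-1 * s + 0)) => // t.
by apply: (is_derive_eq (is_derive_comp_affine (dw _))); rewrite mulN1r addr0 opprK; ring.
Qed.

End calculus.

(** * The second-order linear equation *)

Section second_order.
Variable R : realType.
Variables (al be : R).
Implicit Types (s t : R).
Hypotheses (al0 : 0 < al) (be0 : 0 < be).

(** [p] and [- q] are the roots of [al r ^+ 2 - r - be], so that the operator
    [w |-> - al w'' + w' + be w] is [- al (D - p) (D + q)]. *)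
Lemma characteristic_roots :
  exists p q : R, [/\ 0 < p, 0 < q, al * (p - q) = 1 & al * (p * q) = be].
Proof.
pose r := Num.sqrt (1 + 4 * al * be).
have r2 : r ^+ 2 = 1 + 4 * al * be.
  by rewrite sqr_sqrtr // addr_ge0 // !mulr_ge0 // ltW.
have r1 : 1 < r.
  rewrite -(@ltr_pXn2r _ 2) ?nnegrE ?sqrtr_ge0 // r2 expr1n ltrDl.
  by rewrite !mulr_gt0.
have alN0 : al != 0 by rewrite gt_eqF.
exists ((r + 1) / (2 * al)), ((r - 1) / (2 * al)); split.
- by rewrite divr_gt0 ?mulr_gt0 //; lra.
- by rewrite divr_gt0 ?mulr_gt0 //; lra.
- by field.
- have -> : al * ((r + 1) / (2 * al) * ((r - 1) / (2 * al))) = (r ^+ 2 - 1) / (4 * al).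
    by field.
  by rewrite r2; field.
Qed.

(** The maximum principle on the whole line, from the factorization of the
    operator: the bounded function [v = w' + q w] satisfies [v' <= p v] off the
    origin, hence [0 <= v], which in turn yields [0 <= w]. *)
Lemma second_order_comparison (w w1 w2 : R -> R) (C : R) :
  (forall t, is_derive t 1 w (w1 t)) -> continuous w1 ->
  (forall t : R, t != 0 -> is_derive t 1 w1 (w2 t)) ->
  (forall t, `|w t| <= C) -> (forall t, `|w1 t| <= C) ->
  (forall t : R, t != 0 -> 0 <= w1 t - al * w2 t + be * w t) ->
  forall t, 0 <= w t.
Proof.
move=> dw cw1 dw1 wC w1C ineq.
have [p [q [p0 q0 pq1 pq2]]] := characteristic_roots.
pose v t := 1 * w1 t + q * w t.
have cw := is_derive_all_continuous dw.
have v0 t : 0 <= v t.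
  apply: (@first_order_comparison _ p v (fun t => 1 * w2 t + q * w1 t)
            (C + q * C)) => //.
  - move=> s; apply: cvgD; apply: cvgM => //; first exact: cvg_cst.
    + exact: cw1.
    + exact: cvg_cst.
    + exact: cw.
  - move=> s; rewrite /v mul1r (le_trans (ler_normD _ _)) // lerD //.
    by rewrite normrM (gtr0_norm q0) ler_wpM2l // ltW.
  - move=> s s0; exact: (is_derive_comb 1 q (dw1 s s0) (dw s)).
  - move=> s s0; rewrite -subr_ge0 -(pmulr_rge0 _ al0).
    suff -> : al * (p * v s - (1 * w2 s + q * w1 s)) =
        w1 s - al * w2 s + be * w s by exact: ineq.
    transitivity (al * (p - q) * w1 s - al * w2 s + al * (p * q) * w s).
      by rewrite /v; ring.
    by rewrite pq1 pq2 mul1r.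
apply: (@first_order_comparison_neg _ q w w1 C) => // s s0.
by have := v0 s; rewrite /v; lra.
Qed.

(** Solving one first-order equation for each factor of the operator gives a
    bounded solution.  Since [al (p q) = be], the product of the two first-order
    bounds is [C / be]; that [D] does not depend on [h] gives compactness later. *)
Lemma second_order_solution : exists2 D : R, 0 <= D &
  forall (h : R -> R) (C : R), continuous h -> (forall t, `|h t| <= C) ->
  exists w w1 : R -> R,
    [/\ forall t, is_derive t 1 w (w1 t),
        forall t, is_derive t 1 w1 ((w1 t + be * w t - h t) / al),
        forall t, `|w t| <= C / be & forall t, `|w1 t| <= D * C].
Proof.
have [p [q [p0 q0 pq1 pq2]]] := characteristic_roots.
have alN0 : al != 0 by rewrite gt_eqF.
have pN0 : p != 0 by rewrite gt_eqF.
have qN0 : q != 0 by rewrite gt_eqF.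
exists (2 / (al * p)); first by rewrite divr_ge0 ?mulr_ge0 // ltW.
move=> h C ch hC.
have [||v dv vC] := @first_order_solution_pos _ p (fun t => - al^-1 * h t) (C / al) p0.
- by move=> t; apply: cvgM; [exact: cvg_cst|exact: ch].
- move=> t; have ai0 : 0 <= al^-1 by rewrite invr_ge0 ltW.
  by rewrite normrM normrN (ger0_norm ai0) mulrC ler_wpM2r.
have [||w dw wC] := @first_order_solution _ q v (C / al / p) q0 => //.
  exact: is_derive_all_continuous dv.
exists w, (fun t => (- q) * w t + 1 * v t); split => t.
- by apply: (is_derive_eq (dw t)); rewrite mul1r.
- apply: (is_derive_eq (is_derive_comb (- q) 1 (dw t) (dv t))).
  rewrite -pq2.
  have -> : - q * (- q * w t + v t) + 1 * (p * v t + - al^-1 * h t) =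
    (p * (- q * w t + v t) - q * (- q * w t + v t)) + p * q * w t  - al^-1 * h t by ring.
  rewrite -mulrBl; have -> : p - q = al^-1.
    by apply: (mulfI alN0); rewrite pq1 divff.
  by field.
- apply: le_trans (wC t) _; rewrite -pq2 le_eqVlt; apply/orP; left; apply/eqP.
  by field; rewrite ?alN0 ?pN0 ?qN0.
- rewrite mul1r (le_trans (ler_normD _ _)) //.
  have -> : 2 / (al * p) * C = q * (C / al / p / q) + C / al / p.
    by field; rewrite ?alN0 ?pN0 ?qN0.
  by rewrite lerD // normrM normrN (gtr0_norm q0) ler_wpM2l // ltW.
Qed.

End second_order.

(** * Lipschitz functions and perturbation of the linear equation *)

Section lipschitz_functions.
Variable R : realType.
Implicit Types (g : R -> R) (s t : R).

Definition lipschitz_fun (C : R) g := forall s t, `|g s - g t| <= C * `|s - t|.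

Lemma lipschitz_continuous C g : lipschitz_fun C g -> continuous g.
Proof.
move=> gC t; apply/cvgrPdist_le => e e0.
have C0 : 0 <= C.
  by have := le_trans (normr_ge0 _) (gC 1 0); rewrite subr0 normr1 mulr1.
have C1 : 0 < C + 1 by rewrite ltr_wpDl.
have e1 : 0 < e / (C + 1) by rewrite divr_gt0.
near=> s; apply: le_trans (gC t s) _.
apply: (@le_trans _ _ ((C + 1) * `|t - s|)); first by rewrite ler_wpM2r // lerDl.
rewrite mulrC -(ler_pdivlMr _ _ C1); near: s.
have /cvgr_dist_le := @cvg_id _ (nbhs t); exact.
Unshelve. all: by end_near. Qed.

Lemma max_dist_le (a b a' b' e : R) : `|a - a'| <= e -> `|b - b'| <= e ->
  `|Num.max a b - Num.max a' b'| <= e.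
Proof.
rewrite !ler_distl => /andP[? ?] /andP[? ?].
by case: (leP a b); case: (leP a' b') => ? ?; apply/andP; split; lra.
Qed.

Lemma min_dist_le (a b a' b' e : R) : `|a - a'| <= e -> `|b - b'| <= e ->
  `|Num.min a b - Num.min a' b'| <= e.
Proof.
rewrite !ler_distl => /andP[? ?] /andP[? ?].
by case: (leP a b); case: (leP a' b') => ? ?; apply/andP; split; lra.
Qed.

Lemma bigmax_dist_le (I : finType) (F G : I -> R) (e : R) : 0 <= e ->
  (forall i, `|F i - G i| <= e) ->
  `|\big[Num.max/0]_i F i - \big[Num.max/0]_i G i| <= e.
Proof.
move=> e0 FG; elim/big_rec2: _ => [|i x y _ H]; first by rewrite subrr normr0.
exact: max_dist_le.
Qed.

(** [w] is a solution of [- al w'' + w' + be w = h] with derivative [w1]; the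
    bound [B] makes it the only one, by [linear_solution_dist]. *)
Definition linear_solution (al be : R) (h w w1 : R -> R) (B : R) :=
  [/\ forall t, is_derive t 1 w (w1 t),
      forall t, is_derive t 1 w1 ((w1 t + be * w t - h t) / al),
      forall t, `|w t| <= B & forall t, `|w1 t| <= B].

(** The comparison principle applied to [C - (w - w')]. *)
Lemma linear_solution_le al be (h h' w w1 w' w1' : R -> R) (B B' C : R) :
  0 < al -> 0 < be ->
  linear_solution al be h w w1 B -> linear_solution al be h' w' w1' B' ->
  (forall t, h t - h' t <= C * be) -> forall t, w t - w' t <= C.
Proof.
move=> al0 be0 [dw dw1 wB w1B] [dw' dw1' wB' w1B'] hh t.
have alN0 : al != 0 by rewrite gt_eqF.
rewrite -subr_ge0; have -> : C - (w t - w' t) = 1 * C + 1 * ((-1) * w t + 1 * w' t) by ring.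
move: t.
have dz t : is_derive t 1 (fun t => 1 * C + 1 * ((-1) * w t + 1 * w' t))
    (1 * 0 + 1 * ((-1) * w1 t + 1 * w1' t)).
  exact: (is_derive_comb 1 1 (is_derive_cst C t 1)
    (is_derive_comb (-1) 1 (dw t) (dw' t))).
have dz1 t : is_derive t 1 (fun t => 1 * 0 + 1 * ((-1) * w1 t + 1 * w1' t))
    (1 * 0 + 1 * ((-1) * ((w1 t + be * w t - h t) / al)
                  + 1 * ((w1' t + be * w' t - h' t) / al))).
  exact: (is_derive_comb 1 1 (is_derive_cst 0 t 1)
    (is_derive_comb (-1) 1 (dw1 t) (dw1' t))).
apply: (second_order_comparison al0 be0 dz (is_derive_all_continuous dz1)
  (fun t _ => dz1 t) (C := `|C| + B + B')).
- move=> t; rewrite !mul1r mulN1r addrA (le_trans (ler_normD _ _)) //.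
  by rewrite lerD // (le_trans (ler_normD _ _)) // normrN lerD.
- move=> t; rewrite !mul1r mulN1r add0r (le_trans (ler_normD _ _)) // normrN.
  by rewrite lerD // (le_trans (w1B _)) // lerDr.
- move=> t _; have -> : 1 * 0 + 1 * ((-1) * w1 t + 1 * w1' t) -
    al * (1 * 0 + 1 * ((-1) * ((w1 t + be * w t - h t) / al)
                  + 1 * ((w1' t + be * w' t - h' t) / al))) +
    be * (1 * C + 1 * ((-1) * w t + 1 * w' t)) = C * be - (h t - h' t) by field.
  by rewrite subr_ge0.
Qed.

Lemma linear_solution_dist al be (h h' w w1 w' w1' : R -> R) (B B' C : R) :
  0 < al -> 0 < be ->
  linear_solution al be h w w1 B -> linear_solution al be h' w' w1' B' ->
  (forall t, `|h t - h' t| <= C * be) -> forall t, `|w t - w' t| <= C.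
Proof.
move=> al0 be0 sw sw' hh t; rewrite ler_norml lerNl opprB; apply/andP; split.
  apply: (linear_solution_le al0 be0 sw' sw) => {}t.
  by rewrite (le_trans (ler_norm _)) // distrC.
apply: (linear_solution_le al0 be0 sw sw') => {}t.
by rewrite (le_trans (ler_norm _)).
Qed.

End lipschitz_functions.

(** * Limits along an ultrafilter *)

Section ultralimits.
Variable R : realType.
Implicit Types (w g : R -> R) (s t h : R).

(** Ultrafilters replace the extraction of subsequences: one ultrafilter makes
    all the bounded sequences in play converge at once, at every point of the
    line. *)
Lemma bounded_ultra_cvg (T : Type) (U : set_system T) (x : T -> R) (B : R) :
  UltraFilter U -> (forall m, `|x m| <= B) -> exists l : R, x m @[m --> U] --> l.
Proof.
move=> UU xB; have PU : ProperFilter U by exact: ultra_proper.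
have [|l [_ lc]] := @segment_compact R (- B) B (x @ U).
  by apply: (@filterS _ U _ setT) => [m _|]; [rewrite /= in_itv /= -ler_norml|exact: filterT].
exists l => A lA; have [//|UN] := in_ultra_setVsetC (x @^-1` A) UU.
have [|y []//] := lc (~` A) A _ lA.
exact: UN.
Qed.

Lemma lipschitz_derive_taylor w (w1 : R -> R) (C : R) : (forall t, is_derive t 1 w (w1 t)) ->
  lipschitz_fun C w1 -> forall t h, `|w (t + h) - w t - h * w1 t| <= C * h ^+ 2.
Proof.
move=> dw w1C t h; have cw := is_derive_all_continuous dw.
have C0 : 0 <= C.
  by have := le_trans (normr_ge0 _) (w1C 1 0); rewrite subr0 normr1 mulr1.
have MV s r : s <= r -> exists2 x, s <= x <= r & w r - w s = w1 x * (r - s).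
  move=> sr; have [x xi e] := MVT_segment sr (fun x _ => dw x) (continuous_subspaceT cw).
  by exists x => //; move: xi; rewrite in_itv.
suff [x xt ->] : exists2 x, `|x - t| <= `|h| & w (t + h) - w t = w1 x * h.
  have -> : w1 x * h - h * w1 t = (w1 x - w1 t) * h by ring.
  rewrite normrM -(real_normK (num_real h)) expr2 mulrA ler_wpM2r //.
  by apply: le_trans (w1C _ _) _; rewrite ler_wpM2l.
have [h0|h0] := leP 0 h.
  have [|x /andP[h1 h2] e] := MV t (t + h); first by rewrite lerDl.
  exists x; last by rewrite e; congr (_ * _); ring.
  by rewrite ger0_norm ?subr_ge0 // ger0_norm //; lra.
have [|x /andP[h1 h2] e] := MV (t + h) t; first by rewrite gerDl ltW.
exists x; last by rewrite -[LHS]opprB e; ring.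
by rewrite ler0_norm ?subr_le0 // ltr0_norm //; lra.
Qed.

Lemma taylor_is_derive w (t d C : R) :
  (forall h, `|w (t + h) - w t - h * d| <= C * h ^+ 2) -> is_derive t 1 w d.
Proof.
move=> wC; have C0 : 0 <= C.
  by have := le_trans (normr_ge0 _) (wC 1); rewrite expr1n mulr1.
suff cv : (fun h => h^-1 *: (w (h *: 1 + t) - w t)) @ 0^' --> d.
  by apply: DeriveDef; [exact: cvgP cv|exact: cvg_lim cv].
apply/cvgrPdist_le => e e0.
have e1 : 0 < e / (C + 1) by rewrite divr_gt0 // ltr_wpDl.
near=> h.
have h0 : h != 0 by near: h; exact: nbhs_dnbhs_neq.
have he : `|h| <= e / (C + 1).
  by near: h; apply: filterS (dnbhs0_lt e1) => z; exact: ltW.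
have hE : h *: 1 + t = t + h by rewrite addrC /GRing.scale /= mulr1.
rewrite hE distrC /GRing.scale /=.
have -> : h^-1 * (w (t + h) - w t) - d = h^-1 * (w (t + h) - w t - h * d) by field.
rewrite normrM normfV mulrC ler_pdivrMr ?normr_gt0 //.
rewrite (le_trans (wC h)) // -(real_normK (num_real h)) expr2 mulrA ler_wpM2r //.
move: he; rewrite ler_pdivlMr ?ltr_wpDl // => he.
by rewrite (le_trans _ he) // mulrDr mulr1 mulrC lerDl.
Unshelve. all: by end_near. Qed.

(** A pointwise limit can be differentiated when the derivatives share a
    Lipschitz constant, because the quadratic Taylor remainder bound passes to the
    limit and characterizes the derivative. *)
Lemma is_derive_ultralimit (T : Type) (U : set_system T) (x x1 : T -> R -> R)
    (w w1 : R -> R) (C : R) : ProperFilter U ->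
  (forall m t, is_derive t 1 (x m) (x1 m t)) ->
  (forall m, lipschitz_fun C (x1 m)) ->
  (forall t, x m t @[m --> U] --> w t) -> (forall t, x1 m t @[m --> U] --> w1 t) ->
  forall t, is_derive t 1 w (w1 t).
Proof.
move=> PU dx x1C xw x1w t; apply: (@taylor_is_derive _ _ _ C) => h.
have cv : `|x m (t + h) - x m t - h * x1 m t| @[m --> U] -->
    `|w (t + h) - w t - h * w1 t|.
  apply: cvg_norm; apply: cvgB; first by apply: cvgB.
  by apply: cvgM; [exact: cvg_cst|exact: x1w].
apply: (cvgr_to_le cv); apply: nearW => m.
exact: lipschitz_derive_taylor.
Qed.

(** The points where the [m]-th approximate profile is sampled; only the density
    of their union matters. *)
Definition first_rationals (m : nat) : seq R :=
  [seq ratr q | q <- pmap unpickle (iota 0 m)].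

Lemma first_rationals_dense t (e : R) : 0 < e ->
  \forall m \near \oo, exists2 q, q \in first_rationals m & `|t - q| <= e.
Proof.
move=> e0; have [|q] := @rat_in_itvoo R (t - e) (t + e); first by lra.
rewrite in_itv => /andP[h1 h2]; near=> m; exists (ratr q); last first.
  by rewrite ler_distlC; apply/andP; split; apply: ltW.
apply: map_f; rewrite -[q]/(oapp id q (Some q)) mem_pmap.
apply/mapP; exists (pickle q); last by rewrite pickleK.
by rewrite mem_iota /= add0n; near: m; exact: nbhs_infty_gt.
Unshelve. all: by end_near. Qed.

End ultralimits.

(** * Mixed quasimonotone nonlinearities *)

Section rows.
Variables (R : realType) (n : nat).
Implicit Types (u v p q : 'rV[R]_n) (f : 'rV[R]_n * 'rV[R]_n -> 'rV[R]_n).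

Lemma row_entry_le_norm u j : `|u 0 j| <= `|u|.
Proof.
rewrite [leRHS]/Num.Def.normr/= mx_normrE.
exact: (le_bigmax _ (fun ij => `|u ij.1 ij.2|) (0, j)).
Qed.

Lemma row_norm_le u (e : R) : 0 <= e -> (forall j, `|u 0 j| <= e) -> `|u| <= e.
Proof.
move=> e0 ue; rewrite [leLHS]/Num.Def.normr/= mx_normrE bigmax_le // => -[i j] _.
by rewrite /= (ord1 i).
Qed.

(** Lipschitz continuity for the sup norm, stated entry by entry because all the
    estimates on the wave equation are scalar. *)
Definition entrywise_lipschitz (L : R) f :=
  forall u v u' v' (e : R), (forall j, `|u 0 j - u' 0 j| <= e) ->
    (forall j, `|v 0 j - v' 0 j| <= e) ->
    forall i, `|f (u, v) 0 i - f (u', v') 0 i| <= L * e.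

Lemma lipschitz_entrywise f : (exists L : R, L.-lipschitz f) ->
  exists2 L : R, 0 < L & entrywise_lipschitz L f.
Proof.
move=> [L0 f_lip]; exists (Num.max L0 1); first by rewrite lt_max ltr01 orbT.
move=> u v u' v' e ue ve i; have e0 : 0 <= e := le_trans (normr_ge0 _) (ue i).
have := f_lip ((u, v), (u', v')) (conj Logic.I Logic.I) => /= H.
have -> : f (u, v) 0 i - f (u', v') 0 i = (f (u, v) - f (u', v')) 0 i by rewrite !mxE.
apply: le_trans (row_entry_le_norm _ _) _; apply: (le_trans H).
have L1 : 0 <= Num.max L0 1 by rewrite le_max ler01 orbT.
apply: le_trans (_ : Num.max L0 1 * `|((u, v) : _ * _) - (u', v')| <= _).
  by rewrite ler_wpM2r // le_max lexx.
rewrite ler_wpM2l // prod_normE ge_max /=.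
by apply/andP; split; apply: row_norm_le => // j; rewrite !mxE.
Qed.

Variables (K : 'rV[R]_n) (s : splitting n) (f : 'rV[R]_n * 'rV[R]_n -> 'rV[R]_n).
Hypothesis f_qm : mixed_quasimonotone K s f.

Lemma merge_in_box S p q : in_box K p -> in_box K q -> in_box K (Defs.merge S p q).
Proof. by move=> pK qK j; rewrite mxE; case: ifP. Qed.

Lemma merge_same S p : Defs.merge S p p = p.
Proof. by apply/rowP => j; rewrite mxE if_same. Qed.

Lemma mem_ub i j : (j \in ub s i) = (j \notin (i |: ua s i)%SET).
Proof.
have := uab_disjoint s i; have := uab_cover s i.
move=> /setP/(_ j); rewrite !inE => cov /setP/(_ j); rewrite !inE.
by move: cov; case: (j == i); case: (j \in ua s i); case: (j \in ub s i).
Qed.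

Lemma mem_vd i j : (j \in vd s i) = (j \notin vc s i).
Proof.
have := vcd_disjoint s i; have := vcd_cover s i.
move=> /setP/(_ j); rewrite !inE => cov /setP/(_ j); rewrite !inE.
by move: cov; case: (j \in vc s i); case: (j \in vd s i).
Qed.

Lemma notin_ua i : i \notin ua s i.
Proof.
have := uab_cover s i => /setP/(_ i); rewrite !inE eqxx.
by case: (i \in ua s i).
Qed.

(** Passing from the smaller to the larger arguments one group of entries at a
    time, mixed quasimonotonicity makes [f] increase at each step, except for the
    change of the [i]-th entry of the first argument, about which it says nothing;
    there the Lipschitz condition bounds the loss. *)
Lemma mixed_arg_le (L : R) i p q p' q' P Q P' Q' : entrywise_lipschitz L f ->
  in_box K p -> in_box K q -> in_box K p' -> in_box K q' ->
  in_box K P -> in_box K Q -> in_box K P' -> in_box K Q' ->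
  (forall j, p 0 j <= P 0 j) -> (forall j, Q 0 j <= q 0 j) ->
  (forall j, p' 0 j <= P' 0 j) -> (forall j, Q' 0 j <= q' 0 j) ->
  mixed_arg s f i p q p' q' <= mixed_arg s f i P Q P' Q' + L * (P 0 i - p 0 i).
Proof.
move=> Lf pK qK p'K q'K PK QK P'K Q'K pP Qq p'P' Q'q'; rewrite /mixed_arg.
have [mono_ua anti_ub mono_vc anti_vd] := f_qm i.
pose v0 := Defs.merge (vc s i) p' q'; pose v1 := Defs.merge (vc s i) P' q'.
pose v2 := Defs.merge (vc s i) P' Q'.
pose u0 := Defs.merge (i |: ua s i)%SET p q; pose u1 := Defs.merge (i |: ua s i)%SET p Q.
pose u2 := Defs.merge (ua s i) P u1; pose u3 := Defs.merge (i |: ua s i)%SET P Q.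
have [v0K v1K v2K] : [/\ in_box K v0, in_box K v1 & in_box K v2].
  by split; apply: merge_in_box.
have [u0K u1K u3K] : [/\ in_box K u0, in_box K u1 & in_box K u3].
  by split; apply: merge_in_box.
have u2K : in_box K u2 by apply: merge_in_box.
have H0 : f (u0, v0) 0 i <= f (u1, v0) 0 i.
  apply: anti_ub => //; split=> j; rewrite mem_ub !mxE ?negbK.
    by move=> /negbTE ->.
  by move=> ->.
have H1 : f (u1, v0) 0 i <= f (u2, v0) 0 i.
  apply: mono_ua => //; split=> j ja; rewrite !mxE ?ja ?(negbTE ja) //.
  by rewrite !inE ja orbT.
have H2 : f (u2, v0) 0 i <= f (u2, v1) 0 i.
  by apply: mono_vc => //; split=> j ja; rewrite !mxE ?ja ?(negbTE ja).
have H3 : f (u2, v1) 0 i <= f (u2, v2) 0 i.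
  apply: anti_vd => //; split=> j; rewrite mem_vd !mxE ?negbK.
    by move=> /negbTE ->.
  by move=> ->.
have : `|f (u2, v2) 0 i - f (u3, v2) 0 i| <= L * (P 0 i - p 0 i).
  apply: Lf => j; last by rewrite subrr normr0 subr_ge0.
  rewrite !mxE !inE; have [->|ji] /= := eqVneq j i.
    rewrite (negbTE (notin_ua i)) distrC ger0_norm // subr_ge0 //.
  by case: (j \in ua s i) => /=; rewrite subrr normr0 subr_ge0.
rewrite ler_distl => /andP[_ H4].
by rewrite (le_trans H0) // (le_trans H1) // (le_trans H2) // (le_trans H3).
Qed.

End rows.

(** * Approximate and exact wave profiles *)

(** What is used of one entry [w] of a quasi-solution: [w1] is its derivative,
    bounded by [C], and [w2] its second derivative off the origin. *)
Definition piecewise_C2 (R : realType) (w w1 w2 : R -> R) (C : R) :=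
  [/\ forall t : R, is_derive t 1 w (w1 t), continuous w1,
      forall t : R, t != 0 -> is_derive t 1 w1 (w2 t) &
      forall t : R, `|w1 t| <= C].

Section approximation.
Variables (R : realType) (n : nat) (tau K : 'rV[R]_n) (al : 'I_n -> R) (a L : R).
Variables (f : 'rV[R]_n * 'rV[R]_n -> 'rV[R]_n) (s : splitting n).
Hypotheses (a0 : 0 < a) (al0 : forall i, 0 < al i) (Ka : forall i, K 0 i <= a).
Hypotheses (L0 : 0 < L) (f_lip : entrywise_lipschitz L f) (f0 : f (0, 0) = 0).
Hypothesis f_qm : mixed_quasimonotone K s f.
Variables (upper lower : R -> 'rV[R]_n) (U1 U2 L1 L2 : 'I_n -> R -> R) (C0 : R).
Hypotheses (upper_box : forall t, in_box K (upper t))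
  (lower_box : forall t, in_box K (lower t))
  (lower_le_upper : forall t j, lower t 0 j <= upper t 0 j)
  (upper_C2 : forall i, piecewise_C2 (fun t => upper t 0 i) (U1 i) (U2 i) C0)
  (lower_C2 : forall i, piecewise_C2 (fun t => lower t 0 i) (L1 i) (L2 i) C0)
  (upper_ineq : forall i (t : R), t != 0 ->
     mixed_arg s f i (upper t) (lower t) (delay tau upper t) (delay tau lower t)
       <= U1 i t - al i * U2 i t)
  (lower_ineq : forall i (t : R), t != 0 -> L1 i t - al i * L2 i t <=
     mixed_arg s f i (lower t) (upper t) (delay tau lower t) (delay tau upper t)).
Implicit Types (phi psi : R -> 'rV[R]_n) (t : R).

Definition between phi :=
  forall t j, lower t 0 j <= phi t 0 j <= upper t 0 j.

Definition entries_lipschitz (C : R) phi :=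
  forall j, lipschitz_fun C (fun t => phi t 0 j).

(** The wave equation reads [- al w'' + w' + L w = rhs phi] with [w = phi].  The
    term [L * phi] added on both sides, [L] being a Lipschitz constant of [f], makes
    the right-hand side monotone in the [i]-th entry of [phi t] as well. *)
Definition rhs phi (i : 'I_n) (t : R) : R :=
  L * phi t 0 i + f (phi t, delay tau phi t) 0 i.

Lemma between_box phi t : between phi -> in_box K (phi t).
Proof.
move=> bphi j; have /andP[h1 h2] := bphi t j.
have /andP[h3 _] := lower_box t j; have /andP[_ h4] := upper_box t j.
by rewrite (le_trans h3) //= (le_trans h2).
Qed.

Lemma box_delay phi t : (forall r, in_box K (phi r)) -> in_box K (delay tau phi t).
Proof. by move=> phiK j; rewrite mxE; apply: phiK. Qed.

Lemma rhs_dist phi psi (e : R) i t t' :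
  (forall j, `|phi t 0 j - psi t' 0 j| <= e) ->
  (forall j, `|phi (t - tau 0 j) 0 j - psi (t' - tau 0 j) 0 j| <= e) ->
  `|rhs phi i t - rhs psi i t'| <= 2 * e * L.
Proof.
move=> H1 H2; rewrite /rhs opprD addrACA -mulrBr (le_trans (ler_normD _ _)) //.
have -> : 2 * e * L = L * e + L * e by ring.
rewrite lerD //; first by rewrite normrM gtr0_norm // ler_wpM2l // ltW.
by apply: f_lip => j; rewrite ?mxE.
Qed.

Lemma rhs_bounded phi i t : between phi -> `|rhs phi i t| <= 2 * a * L.
Proof.
move=> bphi; have := @rhs_dist phi (fun=> 0) a i t t.
have -> : rhs (fun=> 0) i t = 0.
  rewrite /rhs mxE mulr0 add0r (_ : delay _ _ _ = 0) ?f0 ?mxE //.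
  by apply/rowP => j; rewrite !mxE.
rewrite subr0; apply => j; rewrite mxE subr0.
  have /andP[h0 h1] := between_box t bphi j.
  by rewrite ger0_norm // (le_trans h1).
have /andP[h0 h1] := between_box (t - tau 0 j) bphi j.
by rewrite ger0_norm // (le_trans h1).
Qed.

Lemma rhs_lipschitz phi i (C : R) : entries_lipschitz C phi ->
  lipschitz_fun (2 * C * L) (rhs phi i).
Proof.
move=> phiC t t'; rewrite mulrAC -[2 * C * _]mulrA.
apply: rhs_dist => j; first exact: phiC.
by apply: le_trans (phiC _ _ _) _; rewrite opprB addrA subrK.
Qed.

(** The loss allowed by [mixed_arg_le] is absorbed by the term [L * phi]. *)
Lemma rhs_upper phi i t : between phi -> t != 0 ->
  rhs phi i t <= L * upper t 0 i + (U1 i t - al i * U2 i t).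
Proof.
move=> bphi t0; have ineq := upper_ineq i t0.
have pK r : in_box K (phi r) by exact: between_box.
have := @mixed_arg_le _ _ K s f f_qm L i (phi t) (phi t) (delay tau phi t)
  (delay tau phi t) (upper t) (lower t) (delay tau upper t) (delay tau lower t)
  f_lip (pK t) (pK t) (box_delay t pK) (box_delay t pK)
  (upper_box t) (lower_box t) (box_delay t upper_box) (box_delay t lower_box).
rewrite {1}/mixed_arg !merge_same /rhs => H.
suff : f (phi t, delay tau phi t) 0 i <=
  mixed_arg s f i (upper t) (lower t) (delay tau upper t) (delay tau lower t) +
  L * (upper t 0 i - phi t 0 i) by lra.
have bt j := andP (bphi t j); have btau j := andP (bphi (t - tau 0 j) j).
by apply: H => j; rewrite ?mxE; [case: (bt j)|case: (bt j)|case: (btau j)|case: (btau j)].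
Qed.

Lemma rhs_lower phi i t : between phi -> t != 0 ->
  L * lower t 0 i + (L1 i t - al i * L2 i t) <= rhs phi i t.
Proof.
move=> bphi t0; have ineq := lower_ineq i t0.
have pK r : in_box K (phi r) by exact: between_box.
have := @mixed_arg_le _ _ K s f f_qm L i
  (lower t) (upper t) (delay tau lower t) (delay tau upper t)
  (phi t) (phi t) (delay tau phi t) (delay tau phi t)
  f_lip (lower_box t) (upper_box t) (box_delay t lower_box) (box_delay t upper_box)
  (pK t) (pK t) (box_delay t pK) (box_delay t pK).
rewrite [mixed_arg _ _ _ (phi t) _ _ _]/mixed_arg !merge_same /rhs => H.
suff : mixed_arg s f i (lower t) (upper t) (delay tau lower t) (delay tau upper t) <=
  f (phi t, delay tau phi t) 0 i + L * (phi t 0 i - lower t 0 i) by lra.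
have bt j := andP (bphi t j); have btau j := andP (bphi (t - tau 0 j) j).
by apply: H => j; rewrite ?mxE; [case: (bt j)|case: (bt j)|case: (btau j)|case: (btau j)].
Qed.

(** The region between the quasi-solutions is invariant under
    [phi |-> w]: by [rhs_upper] and [rhs_lower] the quasi-solutions are upper and
    lower solutions of the linear equation, to which the maximum principle
    applies. *)
Lemma solution_between phi i (w w1 : R -> R) (B : R) : between phi ->
  linear_solution (al i) L (rhs phi i) w w1 B ->
  forall t, lower t 0 i <= w t <= upper t 0 i.
Proof.
move=> bphi [dw dw1 wB w1B].
have alN0 : al i != 0 by rewrite gt_eqF.
have w1c := is_derive_all_continuous dw1.
have in_a (u : 'rV[R]_n) : in_box K u -> `|u 0 i| <= a.
  by move=> uK; have /andP[h0 h1] := uK i; rewrite ger0_norm // (le_trans h1).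
move=> t; rewrite -(subr_ge0 (lower t 0 i)) -[X in _ && X]subr_ge0.
apply/andP; split.
  have [dl l1c dl1 l1C] := lower_C2 i.
  have -> : w t - lower t 0 i = 1 * w t + (-1) * lower t 0 i by ring.
  move: t; apply: (second_order_comparison (al0 i) L0
    (w1 := fun t => 1 * w1 t + (-1) * L1 i t)
    (w2 := fun t => 1 * ((w1 t + L * w t - rhs phi i t) / al i) + (-1) * L2 i t)
    (C := B + (a + C0))) => t.
  - apply: cvgD; apply: cvgM; [exact: cvg_cst|exact: w1c|exact: cvg_cst|exact: l1c].
  - by move=> t0; exact: (is_derive_comb 1 (-1) (dw1 t) (dl1 t t0)).
  - rewrite mul1r mulN1r (le_trans (ler_normB _ _)) // lerD //.
    rewrite (le_trans (in_a _ (lower_box t))) // lerDl.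
    exact: le_trans (normr_ge0 _) (l1C 0).
  - by rewrite mul1r mulN1r (le_trans (ler_normB _ _)) // lerD // ler_wpDl // ltW.
  - move=> t0; have -> : 1 * w1 t + -1 * L1 i t - al i * (1 *
      ((w1 t + L * w t - rhs phi i t) / al i) + -1 * L2 i t) +
      L * (1 * w t + -1 * lower t 0 i) =
      rhs phi i t - (L * lower t 0 i + (L1 i t - al i * L2 i t)) by field.
    by rewrite subr_ge0; exact: rhs_lower.
have [dl l1c dl1 l1C] := upper_C2 i.
have -> : upper t 0 i - w t = (-1) * w t + 1 * upper t 0 i by ring.
move: t; apply: (second_order_comparison (al0 i) L0
  (w1 := fun t => (-1) * w1 t + 1 * U1 i t)
  (w2 := fun t => (-1) * ((w1 t + L * w t - rhs phi i t) / al i) + 1 * U2 i t)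
  (C := B + (a + C0))) => t.
- apply: cvgD; apply: cvgM; [exact: cvg_cst|exact: w1c|exact: cvg_cst|exact: l1c].
- by move=> t0; exact: (is_derive_comb (-1) 1 (dw1 t) (dl1 t t0)).
- rewrite mul1r mulN1r (le_trans (ler_normD _ _)) // normrN lerD //.
  rewrite (le_trans (in_a _ (upper_box t))) // lerDl.
  exact: le_trans (normr_ge0 _) (l1C 0).
- by rewrite mul1r mulN1r (le_trans (ler_normD _ _)) // normrN lerD // ler_wpDl // ltW.
- move=> t0; have -> : -1 * w1 t + 1 * U1 i t - al i * (-1 *
    ((w1 t + L * w t - rhs phi i t) / al i) + 1 * U2 i t) +
    L * (-1 * w t + 1 * upper t 0 i) =
    (L * upper t 0 i + (U1 i t - al i * U2 i t)) - rhs phi i t by field.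
  by rewrite subr_ge0; exact: rhs_upper.
Qed.

(** A finite-dimensional reduction of Schauder's fixed point theorem.  A table [y]
    of values at the points [qs] is extended to a profile [S y] lying between the
    quasi-solutions; the linear equation with right-hand side [rhs (S y)] has a
    solution [W y], which is sampled at [qs] again.  This is a Lipschitz self-map of
    a cube, and an approximate fixed point of it provides [Phi = S y] and [w = W y]
    that nearly agree at the points [qs], hence, both being Lipschitz, also near
    these points. *)
Lemma approximate_profiles : exists Lam B : R, forall (qs : seq R) (e : R), 0 < e ->
  exists (Phi : R -> 'rV[R]_n) (w w1 : 'I_n -> R -> R),
  [/\ between Phi, entries_lipschitz Lam Phi,
      forall i, linear_solution (al i) L (rhs Phi i) (w i) (w1 i) B,
      forall t i, lower t 0 i <= w i t <= upper t 0 i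
    & forall i t q, q \in qs -> `|Phi t 0 i - w i t| <= e + 2 * Lam * `|t - q|].
Proof.
have /choice[D HD] : forall i, exists d : R, 0 <= d /\
  forall (h : R -> R) (C : R), continuous h -> (forall t, `|h t| <= C) ->
  exists w w1 : R -> R,
    [/\ forall t, is_derive t 1 w (w1 t),
        forall t, is_derive t 1 w1 ((w1 t + L * w t - h t) / al i),
        forall t, `|w t| <= C / L & forall t, `|w1 t| <= d * C].
  by move=> i; have [d] := second_order_solution (al0 i) L0; exists d.
pose Dm := \sum_i D i.
have D_Dm i : D i <= Dm.
  rewrite /Dm (bigD1 i) //= lerDl sumr_ge0 // => j _.
  by have [] := HD j.
have Dm0 : 0 <= Dm by rewrite sumr_ge0 // => j _; have [] := HD j.
(* [M] bounds [rhs], and [B] bounds the solutions and their derivatives. *)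
pose M := 2 * a * L.
have M0 : 0 <= M by rewrite /M !mulr_ge0 // ltW.
pose B := M / L + Dm * M; pose Lam := B + `|C0|.
have B0 : 0 <= B by apply: addr_ge0; [exact: divr_ge0 (ltW L0)|exact: mulr_ge0].
have Lam0 : 0 <= Lam by rewrite addr_ge0.
exists Lam, B => qs e e0.
have lip_w (w w1 : R -> R) : (forall t, is_derive t 1 w (w1 t)) ->
    (forall t, `|w1 t| <= Lam) -> lipschitz_fun Lam w.
  by move=> dw wL; exact: bounded_derive_lipschitz dw wL.
have lip_upper i : lipschitz_fun Lam (fun t => upper t 0 i).
  have [dw _ _ wC] := upper_C2 i; apply: lip_w dw _ => t.
  by rewrite (le_trans (wC t)) // (le_trans (ler_norm _)) // lerDr.
have lip_lower i : lipschitz_fun Lam (fun t => lower t 0 i).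
  have [dw _ _ wC] := lower_C2 i; apply: lip_w dw _ => t.
  by rewrite (le_trans (wC t)) // (le_trans (ler_norm _)) // lerDr.
pose I := ('I_n * 'I_(size qs))%type.
(* [env y i] is the least function with Lipschitz constant [Lam] that is
   nonnegative and at least [y] at the points [qs]: it depends on [y] in a
   nonexpansive way and needs no assumption on the position of these points.
   Clamping it between the quasi-solutions makes [S y] admissible for all [y]. *)
pose env (y : I -> R) i t : R :=
  \big[Num.max/0]_(k < size qs) (y (i, k) - Lam * `|t - qs`_k|).
pose clamp i t x := Num.max (lower t 0 i) (Num.min (upper t 0 i) x).
have clamp_id i t x : lower t 0 i <= x <= upper t 0 i -> clamp i t x = x.
  by move=> /andP[h1 h2]; rewrite /clamp (min_idPr h2) (max_idPr h1).
have clamp_dist i t x x' r : `|x - x'| <= r -> `|clamp i t x - clamp i t x'| <= r.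
  move=> xr; have r0 := le_trans (normr_ge0 _) xr.
  by apply: max_dist_le; [|apply: min_dist_le]; rewrite ?subrr ?normr0.
pose S y t : 'rV[R]_n := \row_i clamp i t (env y i t).
have S_between y : between (S y).
  move=> t j; rewrite mxE /clamp le_max lexx /= ge_max lower_le_upper /=.
  by rewrite ge_min lexx.
have S_lip y : entries_lipschitz Lam (S y).
  move=> j t t'; rewrite !mxE.
  have r0 : 0 <= Lam * `|t - t'| by rewrite mulr_ge0.
  apply: max_dist_le; first exact: lip_lower.
  apply: min_dist_le; first exact: lip_upper.
  apply: bigmax_dist_le => // k.
  have -> : y (j, k) - Lam * `|t - qs`_k| - (y (j, k) - Lam * `|t' - qs`_k|) =
    Lam * (`|t' - qs`_k| - `|t - qs`_k|) by ring.
  rewrite normrM (ger0_norm Lam0) ler_wpM2l // distrC.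
  by rewrite (le_trans (ler_dist_dist _ _)) // opprB addrA subrK.
have /choice[W HW] : forall yi : (I -> R) * 'I_n, exists ww : (R -> R) * (R -> R),
    linear_solution (al yi.2) L (rhs (S yi.1) yi.2) ww.1 ww.2 B.
  move=> [y i] /=.
  have [_ /(_ (rhs (S y) i) M)] := HD i.
  case=> [|t|w [w1 [dw dw1 wC w1C]]].
  - exact: lipschitz_continuous (rhs_lipschitz i (S_lip y)).
  - exact: rhs_bounded.
  exists (w, w1); split => // t /=.
    by rewrite (le_trans (wC t)) // lerDl mulr_ge0.
  rewrite (le_trans (w1C t)) // (@le_trans _ _ (Dm * M)) ?ler_wpM2r //.
  by rewrite lerDr divr_ge0 // ltW.
have W_between y i t : lower t 0 i <= (W (y, i)).1 t <= upper t 0 i.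
  exact: solution_between (HW (y, i)) t.
have [|x y r xyr [i k]|x [i k]|x Hx] := @approximate_fixed_point R I a 2
  (fun y ik => (W (y, ik.1)).1 qs`_(ik.2)) a0 _ _ _ e e0.
- by [].
- have r0 := le_trans (normr_ge0 _) (xyr (i, k)).
  move: (qs`_k); apply: (linear_solution_dist (al0 i) L0 (HW (x, i)) (HW (y, i))) => t.
  have S_dist t' j : `|S x t' 0 j - S y t' 0 j| <= r.
    rewrite !mxE; apply: clamp_dist; apply: bigmax_dist_le => // m.
    have -> : x (j, m) - Lam * `|t' - qs`_m| - (y (j, m) - Lam * `|t' - qs`_m|) =
      x (j, m) - y (j, m) by ring.
    exact: xyr.
  by apply: rhs_dist => j.
- have /andP[h1 h2] := W_between x i qs`_k.
  have /andP[h3 _] := lower_box qs`_k i; have /andP[_ h4] := upper_box qs`_k i.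
  by rewrite (le_trans h3) //= (le_trans h2) // (le_trans h4).
exists (S x), (fun i => (W (x, i)).1), (fun i => (W (x, i)).2); split.
- exact: S_between.
- exact: S_lip.
- by move=> i; exact: (HW (x, i)).
- by move=> t i; exact: W_between.
move=> i t q /(nthP 0)[m m_lt <-].
rewrite mxE -[X in _ - X](clamp_id i t) //; apply: clamp_dist.
have wL : lipschitz_fun Lam (W (x, i)).1.
  have [dw _ _ wB] := HW (x, i); apply: lip_w dw _ => r.
  by rewrite (le_trans (wB r)) // lerDl.
have w0 : 0 <= (W (x, i)).1 t.
  have /andP[h1 _] := W_between x i t; have /andP[h2 _] := lower_box t i.
  exact: le_trans h1.
have Hk (k : 'I_(size qs)) : `|(W (x, i)).1 qs`_k - x (i, k)| <= e := Hx (i, k).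
rewrite ler_distl; apply/andP; split.
  have := le_bigmax 0 (fun k : 'I_(size qs) => x (i, k) - Lam * `|t - qs`_k|)
    (Ordinal m_lt).
  rewrite -/(env x i t) /=; have := Hk (Ordinal m_lt); rewrite ler_distl /=.
  have := wL t qs`_m; rewrite ler_distl => /andP[_ ?] /andP[_ ?]; lra.
apply: bigmax_le => [|k _].
  by rewrite addr_ge0 // addr_ge0 ?(ltW e0) // !mulr_ge0.
have := Hk k; have := wL t qs`_k; rewrite !ler_distl.
have : 0 <= 2 * Lam * `|t - qs`_m| by rewrite !mulr_ge0.
by move=> ? /andP[? ?] /andP[? ?]; lra.
Qed.

(** Along an ultrafilter the approximate profiles, sampled at more and more
    rationals with smaller and smaller error, converge with their derivatives.
    The second derivatives converge because the equation expresses them through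
    quantities that do, and both [w'] and [w''] are uniformly Lipschitz. *)
Lemma profile_exists : exists (W W1 : 'I_n -> R -> R) (B : R),
  let phi t : 'rV[R]_n := \row_i W i t in
  between phi /\ forall i, linear_solution (al i) L (rhs phi i) (W i) (W1 i) B.
Proof.
have [Lam [B approx]] := approximate_profiles.
have /choice[X HX] : forall m : nat,
    exists X : (R -> 'rV[R]_n) * (('I_n -> R -> R) * ('I_n -> R -> R)),
    [/\ between X.1, entries_lipschitz Lam X.1,
      forall i, linear_solution (al i) L (rhs X.1 i) (X.2.1 i) (X.2.2 i) B,
      forall t i, lower t 0 i <= X.2.1 i t <= upper t 0 i
    & forall i t q, q \in first_rationals R m ->
        `|X.1 t 0 i - X.2.1 i t| <= m.+1%:R^-1 + 2 * Lam * `|t - q|].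
  move=> m; have [|Phi [w [w1 H]]] := approx (first_rationals R m) m.+1%:R^-1.
    by rewrite invr_gt0 ltr0n.
  by exists (Phi, (w, w1)).
pose Phi m := (X m).1; pose w m := (X m).2.1; pose w1 m := (X m).2.2.
have Phi_between m : between (Phi m) by have [] := HX m.
have Phi_lip m : entries_lipschitz Lam (Phi m) by have [] := HX m.
have sol m i : linear_solution (al i) L (rhs (Phi m) i) (w m i) (w1 m i) B.
  by have [_ _ /(_ i)] := HX m.
have dw m i t : is_derive t 1 (w m i) (w1 m i t) by have [] := sol m i.
have dw1 m i t : is_derive t 1 (w1 m i)
  ((w1 m i t + L * w m i t - rhs (Phi m) i t) / al i) by have [] := sol m i.
have wB m i t : `|w m i t| <= B by have [] := sol m i.
have w1B m i t : `|w1 m i t| <= B by have [] := sol m i.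
have w_between m i t : lower t 0 i <= w m i t <= upper t 0 i.
  by have [_ _ _ /(_ t i)] := HX m.
have [U [UU ooU]] := ultraFilterLemma eventually_filter.
have PU : ProperFilter U by exact: ultra_proper.
have /choice[W' HW'] : forall it : 'I_n * R, exists l : R, w m it.1 it.2 @[m --> U] --> l.
  by move=> [i t]; apply: (@bounded_ultra_cvg _ _ _ _ B) => m.
have /choice[W1' HW1'] : forall it : 'I_n * R, exists l : R, w1 m it.1 it.2 @[m --> U] --> l.
  by move=> [i t]; apply: (@bounded_ultra_cvg _ _ _ _ B) => m.
pose W i t := W' (i, t); pose W1 i t := W1' (i, t).
have cvW i t : w m i t @[m --> U] --> W i t by exact: HW' (i, t).
have cvW1 i t : w1 m i t @[m --> U] --> W1 i t by exact: HW1' (i, t).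
pose phi t : 'rV[R]_n := \row_i W i t.
have cvPhi i t : Phi m t 0 i @[m --> U] --> phi t 0 i.
  have Lam0 : 0 <= Lam.
    by have := le_trans (normr_ge0 _) (Phi_lip 0 i 1 0); rewrite subr0 normr1 mulr1.
  have -> : (fun m => Phi m t 0 i) = (fun m => (Phi m t 0 i - w m i t) + w m i t).
    by apply: funext => m; rewrite subrK.
  rewrite mxE -[W i t]add0r; apply: cvgD; last exact: cvW.
  apply/cvgrPdist_le => e e0; apply: ooU.
  have d0 : 0 < e / 2 / (2 * Lam + 1) by rewrite !divr_gt0 // ltr_wpDl // mulr_ge0.
  have e2 : 0 < e / 2 by rewrite divr_gt0.
  near=> m; rewrite sub0r normrN.
  have [q qm tq] : exists2 q, q \in first_rationals R m &
      `|t - q| <= e / 2 / (2 * Lam + 1).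
    by near: m; exact: first_rationals_dense.
  have [_ _ _ _ /(_ i t q qm) H] := HX m; apply: (le_trans H).
  rewrite [e]splitr lerD //.
    apply: ltW; near: m; exact: (near_infty_natSinv_lt (PosNum e2)).
  move: tq; rewrite ler_pdivlMr ?ltr_wpDl ?mulr_ge0 //.
  have := normr_ge0 (t - q); move: (`|t - q|) => z; nra.
have cvrhs i t : rhs (Phi m) i t @[m --> U] --> rhs phi i t.
  apply/cvgrPdist_le => e e0.
  have d0 : 0 < e / (2 * L) by rewrite divr_gt0 ?mulr_gt0.
  near=> m; have -> : e = 2 * (e / (2 * L)) * L.
    by field; rewrite gt_eqF.
  apply: rhs_dist; near: m; apply: filter_forall => j;
    exact: (cvgr_dist_le _ _ (cvPhi j _) _ d0).
exists W, W1, B => /=; rewrite -/phi.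
have phi_between : between phi.
  move=> t i; rewrite mxE; apply/andP; split.
    apply: (cvgr_to_ge (cvW i t)); apply: nearW => m.
    by have /andP[] := w_between m i t.
  apply: (cvgr_to_le (cvW i t)); apply: nearW => m.
  by have /andP[] := w_between m i t.
split => // i.
pose w2 m t := (w1 m i t + L * w m i t - rhs (Phi m) i t) / al i.
have cvw2 t : w2 m t @[m --> U] --> (W1 i t + L * W i t - rhs phi i t) / al i.
  apply: cvgM; last exact: cvg_cst.
  apply: cvgB; last exact: cvrhs.
  apply: cvgD; first exact: cvW1.
  by apply: cvgM; [exact: cvg_cst|exact: cvW].
pose C2 := (B + L * B + 2 * a * L) / al i.
have w1_lip m : lipschitz_fun C2 (w1 m i).
  apply: (bounded_derive_lipschitz (dw1 m i)) => t.
  rewrite normrM normfV (gtr0_norm (al0 i)) ler_wpM2r ?invr_ge0 ?(ltW (al0 i)) //.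
  rewrite (le_trans (ler_normB _ _)) // lerD ?rhs_bounded //.
  by rewrite (le_trans (ler_normD _ _)) // lerD // normrM gtr0_norm // ler_wpM2l // ltW.
pose C3 := (C2 + L * B + 2 * Lam * L) / al i.
have w2_lip m : lipschitz_fun C3 (w2 m).
  move=> r t.
  have -> : w2 m r - w2 m t = ((w1 m i r - w1 m i t) + L * (w m i r - w m i t) -
     (rhs (Phi m) i r - rhs (Phi m) i t)) / al i.
    by rewrite /w2; field; rewrite gt_eqF.
  rewrite normrM normfV (gtr0_norm (al0 i)) /C3 mulrAC.
  rewrite ler_wpM2r ?invr_ge0 ?(ltW (al0 i)) //.
  rewrite (le_trans (ler_normB _ _)) // [leRHS]mulrDl lerD ?(rhs_lipschitz i (Phi_lip m)) //.
  rewrite (le_trans (ler_normD _ _)) // [leRHS]mulrDl lerD //; first exact: w1_lip.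
  rewrite normrM gtr0_norm // -mulrA ler_wpM2l ?(ltW L0) //.
  exact: (bounded_derive_lipschitz (dw m i) (w1B m i)).
split.
- by apply: (is_derive_ultralimit PU _ w1_lip (cvW i) (cvW1 i)) => m t.
- by apply: (is_derive_ultralimit PU _ w2_lip (cvW1 i) cvw2) => m t.
- move=> t; apply: (cvgr_to_le (cvg_norm (cvW i t))); exact: nearW.
- move=> t; apply: (cvgr_to_le (cvg_norm (cvW1 i t))); exact: nearW.
Unshelve. all: by end_near. Qed.

End approximation.

(** * Calculus for row-valued functions *)

Section row_calculus.
Variables (R : realType) (n : nat).
Implicit Types (g : R -> 'rV[R]_n) (t : R).

Lemma is_derive_derive1 (V : normedModType R) (g : R -> V) (t : R) (v : V) :
  is_derive t 1 g v -> g^`() t = v.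
Proof. by move=> [_ <-]; rewrite derive1E. Qed.

Lemma is_derive_entry g t i : derivable g t 1 ->
  is_derive t 1 (fun s => g s 0 i) (g^`() t 0 i).
Proof.
move=> dg; apply: DeriveDef; first exact: (derivable_mxP g t 1).1.
by rewrite derive1E derive_mx // mxE.
Qed.

Lemma is_derive_row g t (v : 'rV[R]_n) :
  (forall i, is_derive t 1 (fun s => g s 0 i) (v 0 i)) -> is_derive t 1 g v.
Proof.
move=> dg; have der : derivable g t 1.
  by apply/derivable_mxP => i j; rewrite (ord1 i); have [] := dg j.
apply: DeriveDef => //; rewrite derive_mx //.
by apply/rowP => i; rewrite mxE; have [_] := dg i.
Qed.

Lemma continuous_entry g i : continuous g -> continuous (fun t => g t 0 i).
Proof.
move=> cg t; apply/cvgrPdist_le => e e0; have /cvgrPdist_le/(_ e e0) := cg t.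
apply: filterS => s; apply: le_trans.
by have := row_entry_le_norm (g t - g s) i; rewrite !mxE.
Qed.

Lemma continuous_row g : (forall i, continuous (fun t => g t 0 i)) -> continuous g.
Proof.
move=> cg t; apply/cvgrPdist_le => e e0.
near=> s; apply: row_norm_le => [|i]; first exact: ltW.
rewrite !mxE; move: i; near: s; apply: filter_forall => i.
by have /cvgrPdist_le/(_ e e0) := cg i t.
Unshelve. all: by end_near. Qed.

Lemma bounded_row_entries g : bounded_fun g ->
  exists C : R, forall t i, `|g t 0 i| <= C.
Proof.
have PF : ProperFilter (globally [set: R]) := @globally_properfilter _ _ 0 Logic.I.
move=> /ex_bound[C Cg]; exists C => t i.
exact: le_trans (row_entry_le_norm _ _) (Cg t Logic.I).
Qed.

Lemma row_bounded g (C : R) : 0 <= C -> (forall t i, `|g t 0 i| <= C) ->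
  bounded_fun g.
Proof.
have PF : ProperFilter (globally [set: R]) := @globally_properfilter _ _ 0 Logic.I.
move=> C0 gC; apply/ex_bound; exists C => t _.
exact: row_norm_le.
Qed.

Lemma quasi_regular_entries g : quasi_regular g -> exists C : R, forall i,
  piecewise_C2 (fun t => g t 0 i) (fun t => g^`() t 0 i) (fun t => g^`(2) t 0 i) C.
Proof.
move=> [[dg cg] dg1 _ _ _].
have [_ /bounded_row_entries[C gC]] := cg 1%N isT.
exists C => i; split.
- by move=> t; apply: is_derive_entry; exact: (dg 0%N).
- by apply: continuous_entry; have [] := cg 1%N isT.
- by move=> t /dg1[d2 _]; exact: is_derive_entry.
- by move=> t; exact: gC.
Qed.

End row_calculus.

(** * Existence of a traveling wave *)

Unset Implicit Arguments.

Theorem theorem3p1 (R : realType) (n : nat) (hn : (1 <= n)%N)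
    (d tau K : 'rV[R]_n) (c : R)
    (hd : forall i, 0 < d 0 i) (htau : forall i, 0 < tau 0 i)
    (hK : forall i, 0 < K 0 i) (hc : 0 < c)
    (f : 'rV[R]_n * 'rV[R]_n -> 'rV[R]_n)
    (f_lip : exists L : R, L.-lipschitz f)
    (f0 : f (0, 0) = 0) (fK : f (K, K) = 0)
    (f_C1 : C1_fun f)
    (s : splitting n) (f_qm : mixed_quasimonotone K s f)
    (upper lower : R -> 'rV[R]_n)
    (upper_box : Cbox K upper) (lower_box : Cbox K lower)
    (h_coupled : coupled_quasi_solutions d tau c s f upper lower)
    (upper_ninfty : upper t @[t --> -oo] --> (0 : 'rV[R]_n))
    (lower_pinfty : lower t @[t --> +oo] --> K) :
  exists phi : R -> 'rV[R]_n,
    [/\ Cb 2 phi,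
        solves_wave_eq d tau c f phi,
        phi t @[t --> -oo] --> (0 : 'rV[R]_n),
        phi t @[t --> +oo] --> K
      & solves_pde d tau f (fun x t => phi (t + x / c))].
Proof.
have [upper_reg lower_reg lower_le_upper upper_ineq lower_ineq] := h_coupled.
have [_ upK] := upper_box; have [_ lowK] := lower_box.
have [L L0 f_elip] := lipschitz_entrywise f_lip.
(* A wave [phi (t + x / c)] turns the diffusion coefficient [d] into [al]. *)
pose al i : R := d 0 i / c ^+ 2.
have al0 i : 0 < al i by rewrite divr_gt0 // exprn_gt0.
have alN0 i : al i != 0 by rewrite gt_eqF.
have cN0 : c != 0 by rewrite gt_eqF.
pose a : R := 1 + \sum_j K 0 j.
have sumK0 : 0 <= \sum_j K 0 j by apply: sumr_ge0 => j _; apply: ltW.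
have a0 : 0 < a by rewrite /a ltr_pwDl.
have Ka i : K 0 i <= a.
  rewrite /a (bigD1 i) //= addrCA lerDl addr_ge0 // sumr_ge0 // => j _.
  exact: ltW.
have [Cu up_C2'] := quasi_regular_entries upper_reg.
have [Cl low_C2'] := quasi_regular_entries lower_reg.
pose C0 := Num.max Cu Cl.
have up_C2 i : piecewise_C2 (fun t => upper t 0 i) (fun t => upper^`() t 0 i)
    (fun t => upper^`(2) t 0 i) C0.
  by have [? ? ? H] := up_C2' i; split=> // t; rewrite le_max H.
have low_C2 i : piecewise_C2 (fun t => lower t 0 i) (fun t => lower^`() t 0 i)
    (fun t => lower^`(2) t 0 i) C0.
  by have [? ? ? H] := low_C2' i; split=> // t; rewrite le_max H orbT.
have [W [W1 [B [bphi sol]]]] := profile_exists a0 al0 Ka L0 f_elip f0 f_qm upK lowK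
  lower_le_upper up_C2 low_C2 upper_ineq lower_ineq.
set phi := fun t => \row_i W i t in bphi sol.
have i0 : 'I_n := Ordinal hn.
have WB i t : `|W i t| <= B by have [] := sol i.
have W1B i t : `|W1 i t| <= B by have [] := sol i.
have B0 : 0 <= B := le_trans (normr_ge0 _) (WB i0 0).
have dW i (t : R) : is_derive t 1 (W i) (W1 i t) by have [] := sol i.
pose W2 i (t : R) : R := (W1 i t + L * W i t - rhs tau L f phi i t) / al i.
have dW1 i (t : R) : is_derive t 1 (W1 i) (W2 i t) by have [] := sol i.
have phiE i : (fun t => phi t 0 i) = W i by apply: funext => t; rewrite mxE.
pose phi1 (t : R) : 'rV[R]_n := \row_i W1 i t.
pose phi2 (t : R) : 'rV[R]_n := \row_i W2 i t.
have phi1E i : (fun t => phi1 t 0 i) = W1 i by apply: funext => t; rewrite mxE.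
have phi2E i : (fun t => phi2 t 0 i) = W2 i by apply: funext => t; rewrite mxE.
have dphi (t : R) : is_derive t 1 phi (phi1 t).
  by apply: is_derive_row => i; rewrite phiE mxE.
have dphi1 (t : R) : is_derive t 1 phi1 (phi2 t).
  by apply: is_derive_row => i; rewrite phi1E mxE.
have E1 : phi^`() = phi1 by apply: funext => t; exact: is_derive_derive1 (dphi t).
have E2 : phi^`(2) = phi2.
  rewrite -[LHS]/((phi^`())^`()) E1.
  by apply: funext => t; exact: is_derive_derive1 (dphi1 t).
have phi_lip : entries_lipschitz B phi.
  move=> i; rewrite phiE; exact: bounded_derive_lipschitz (dW i) (W1B i).
have rhs_lip i := rhs_lipschitz tau L0 f_elip i phi_lip.
have wave i (t : R) : W1 i t - al i * W2 i t = f (phi t, delay tau phi t) 0 i.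
  rewrite /W2 mulrC divfK // /rhs mxE; ring.
have phi_Cb : Cb 2 phi.
  pose b i := (B + L * B + 2 * a * L) / al i.
  have b0 i : 0 <= b i.
    by rewrite divr_ge0 ?(ltW (al0 i)) // !addr_ge0 // ?mulr_ge0 // ltW.
  have W2b i t : `|W2 i t| <= b i.
    rewrite normrM normfV (gtr0_norm (al0 i)) ler_wpM2r ?invr_ge0 ?(ltW (al0 i)) //.
    rewrite (le_trans (ler_normB _ _)) // lerD //; last first.
      exact: (rhs_bounded tau Ka L0 f_elip f0 upK lowK i t bphi).
    by rewrite (le_trans (ler_normD _ _)) // lerD // normrM gtr0_norm // ler_wpM2l // ltW.
  split=> [[|[|//]] _ t|[|[|[|//]]] _].
  - by have [] := dphi t.
  - by rewrite -[phi^`(1)]/(phi^`()) E1; have [] := dphi1 t.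
  - split; first by apply: continuous_row => i; rewrite phiE; exact: is_derive_all_continuous (dW i).
    by apply: (row_bounded B0) => t i; rewrite mxE.
  - rewrite -[phi^`(1)]/(phi^`()) E1; split.
      apply: continuous_row => i; rewrite phi1E.
      exact: is_derive_all_continuous (dW1 i).
    by apply: (row_bounded B0) => t i; rewrite mxE.
  - rewrite E2; split.
      apply: continuous_row => i; rewrite phi2E => t.
      apply: cvgM; last exact: cvg_cst.
      apply: cvgB; last exact: lipschitz_continuous (rhs_lip i) t.
      apply: cvgD; first exact: is_derive_all_continuous (dW1 i) t.
      apply: cvgM; first exact: cvg_cst.
      exact: is_derive_all_continuous (dW i) t.
    apply: (@row_bounded _ _ _ (\sum_i b i)) => [|t i]; first exact: sumr_ge0.
    by rewrite mxE (le_trans (W2b i t)) // (bigD1 i) //= lerDl sumr_ge0.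
exists phi; split.
- exact: phi_Cb.
- by move=> i t; rewrite /wave_op E1 E2 /phi1 /phi2 !mxE wave.
- apply/cvgrPdist_le => e e0; have /cvgrPdist_le/(_ e e0) := upper_ninfty.
  apply: filterS => t; apply: le_trans; rewrite !sub0r !normrN.
  apply: row_norm_le => // i; have /andP[h1 h2] := bphi t i.
  have /andP[h3 _] := lowK t i.
  rewrite ger0_norm; last exact: le_trans h1.
  apply: le_trans h2 _; apply: le_trans (ler_norm _) _.
  exact: row_entry_le_norm.
- apply/cvgrPdist_le => e e0; have /cvgrPdist_le/(_ e e0) := lower_pinfty.
  apply: filterS => t; apply: le_trans.
  apply: row_norm_le => // i; have /andP[h1 h2] := bphi t i.
  have /andP[_ h3] := upK t i.
  have := row_entry_le_norm (K - lower t) i; rewrite !mxE; apply: le_trans.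
  move: h1 h2; rewrite mxE => h1 h2.
  have WK : W i t <= K 0 i := le_trans h2 h3.
  rewrite !ger0_norm ?subr_ge0 //; last exact: le_trans h1 WK.
  by rewrite lerD2l lerN2.
move=> x t.
have du (r : R) : is_derive r 1 (fun r => phi (r + x / c)) (phi1 (r + x / c)).
  apply: is_derive_row => i; rewrite mxE.
  have /is_derive_comp_affine : is_derive (1 * r + x / c) 1 (W i) (W1 i (r + x / c)).
    by rewrite mul1r.
  rewrite mulr1; congr is_derive; apply: funext => z; first by rewrite mxE mul1r.
have dy (g g1 : R -> 'rV[R]_n) (y : R) : (forall z : R, is_derive z 1 g (g1 z)) ->
    is_derive y 1 (fun y => g (t + y / c)) (c^-1 *: g1 (t + y / c)).
  move=> dg; apply: is_derive_row => i.
  have dgi : is_derive (c^-1 * y + t) 1 (fun z => g z 0 i) (g1 (t + y / c) 0 i).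
    have [dgz gz] := dg (c^-1 * y + t).
    apply: (is_derive_eq (is_derive_entry _ dgz)).
    by rewrite derive1E gz [in RHS]addrC [y / c]mulrC.
  have := is_derive_comp_affine dgi; rewrite mxE [_ * c^-1]mulrC.
  by congr is_derive; apply: funext => z; rewrite [t + _]addrC [z / c]mulrC.
have uy1 : (fun y => phi (t + y / c))^`() = fun y => c^-1 *: phi1 (t + y / c).
  by apply: funext => y; exact: is_derive_derive1 (dy _ _ y dphi).
have duy1 (y : R) : is_derive y 1 (fun y => c^-1 *: phi1 (t + y / c))
    (c^-1 *: (c^-1 *: phi2 (t + y / c))).
  by apply: is_deriveZ; apply: dy.
split.
- by have [] := du t.
- by have [] := dy _ _ x dphi.
- by rewrite uy1; have [] := duy1 x.
move=> i; rewrite (is_derive_derive1 (du t)).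
rewrite -[(fun y => phi (t + y / c))^`(2)]/((fun y => phi (t + y / c))^`()^`()) uy1.
rewrite (is_derive_derive1 (duy1 x)) !mxE.
have -> : delay tau (fun r => phi (r + x / c)) t = delay tau phi (t + x / c).
  by apply/rowP => j; rewrite !mxE addrAC.
by rewrite -wave /al; field.
Qed.
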